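(* Let $G$ and $\Gamma$ be locally compact abelian (LCA) groups under Pontryagin duality $\varpi\colon\Gamma\times G\to\mathbb{T}$. Let $\mathcal F\colon L^1(G)\to C_0(\Gamma)$ be given by $$\mathcal F s(\xi)=\int_G\langle\xi|y\rangle\,s(y)\,dy .$$ Then $[\mathcal F\colon L^1(G)\to C_0(\Gamma)]$ is a Fourier doublet over $\varpi$ with reversal operators $\mathcal P\colon L^1(G)\to L^1(G)$, $(\mathcal P s)(y)=s(-y)$, and $\mathcal P\colon C_0(\Gamma)\to C_0(\Gamma)$, $(\mathcal P\sigma)(\eta)=\sigma(-\eta)$. Here $L^1(G)$ carries the convolution product and $C_0(\Gamma)$ the pointwise product, with the Heisenberg actions specified in the context.
   Context: $\mathbb{T}\subset\mathbb{C}$ is the unit circle group. $\Gamma=\hat G$ is the character group of $G$ and $\varpi(\xi,x)=\langle\xi|x\rangle:=\xi(x)$; $G,\Gamma$ are written additively. $L^1(G)$ is taken with respect to Haar measure; $C_0(\Gamma)$ is the space of continuous functions $\Gamma\to\mathbb{C}$ vanishing at infinity. The Heisenberg group $H(\varpi)$ consists of all $c\,(x,\xi)$, $c\in\mathbb T,x\in G,\xi\in\Gamma$, with product $c(x,\xi)\cdot c'(x',\xi')=cc'\langle\xi|x'\rangle(x+x',\xi+\xi')$; $\mathbb T,G,\Gamma$ are identified with the evident subgroups. A left Heisenberg algebra over $\varpi$ is a (commutative, not necessarily unital) $\mathbb{C}$-algebra $S$ with a $\mathbb{C}$-linear left action $\bullet$ of $H(\varpi)$ such that $c\bullet s=cs$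 for $c\in\mathbb T$, $x\bullet(ss')=(x\bullet s)s'$ for $x\in G$, and $\xi\bullet(ss')=(\xi\bullet s)(\xi\bullet s')$ for $\xi\in\Gamma$. A right Heisenberg algebra is defined in the same way with a linear right action of $H(\varpi)$ (elements of $\mathbb T G$ acting as scalars: $(\sigma\sigma')\bullet x=\sigma(\sigma'\bullet x)$; elements of $\Gamma$ as operators: $(\sigma\sigma')\bullet\xi=(\sigma\bullet\xi)(\sigma'\bullet\xi)$; $\mathbb T$ acting by multiplication). Let $S$ be a left and $\Sigma$ a right Heisenberg algebra. A (forward) Fourier operator $\mathcal F\colon S\to\Sigma$ is a $\mathbb{C}$-algebra homomorphism with $\mathcal F(x\bullet s)=\mathcal F(s)\bullet x$ and $\mathcal F(\xi\bullet s)=\mathcal F(s)\bullet(-\xi)$ for $x\in G,\xi\in\Gamma,s\in S$; then $[\mathcal F\colon S\to\Sigma]$ is called a Fourier doublet. A reversal operator on a (left or right) Heisenberg algebra is an involutive algebra homomorphism $\mathcal P$ with $\mathcal P(x\bullet s)=(-x)\bullet\mathcal P(s)$ and $\mathcal P(\xi\bullet s)=(-\xi)\bullet\mathcal P(s)$ (resp. the same with right actions). In a Fourier doublet with reversal operators, $\mathcal F$ is required to commute with them: $\mathcal F\mathcal P=\mathcal P\mathcal F$. Actions: on $L^1(G)$, $(x\bullet s)(y)=s(y-x)$, $(\xi\bullet s)(y)=\langle\xi|y\rangle s(y)$; on $C_0(\Gamma)$, $(\sigma\bullet\xi)(\eta)=\sigma(\eta-\xi)$, $(\sigma\bullet x)(\eta)=\langle\eta|x\rangle\sigma(\eta)$;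 $\mathbb T$ acts by scalar multiplication. *)

(* Defs.v *)
From HB Require Import structures.
From mathcomp Require Import all_boot all_order all_algebra.
From mathcomp Require Import generic_quotient ring_quotient.
From mathcomp Require Import all_classical all_reals all_analysis.
From mathcomp Require Import measurable_realfun complex ring.

Set Implicit Arguments.
Unset Strict Implicit.
Unset Printing Implicit Defensive.

Import Order.TTheory GRing.Theory Num.Theory.
Import numFieldNormedType.Exports.

Local Open Scope classical_set_scope.
Local Open Scope ring_scope.

Definition circle (R : realType) : Type := {z : R[i] | `|z| == 1}.

Section Circle.
Context {R : realType}.

HB.instance Definition _ := SubChoice.copy (circle R) {z : R[i] | `|z| == 1}.

(* [R[i]] has its norm topology through the alias [R[i]^o]. *)
HB.instance Definition _ := Uniform.copy (circle R)
  (initial_topology (val : circle R -> R[i]^o)).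

Implicit Types a b c : circle R.

Lemma circle_norm a : `|val a| = 1. Proof. exact/eqP/(valP a). Qed.

Lemma circle_neq0 a : val a != 0.
Proof. by rewrite -normr_eq0 circle_norm oner_eq0. Qed.

Fact circle_one_subproof : `|1 : R[i]| == 1. Proof. by rewrite normr1. Qed.
Fact circle_inv_subproof a : `|(val a)^-1| == 1.
Proof. by rewrite normfV circle_norm invr1. Qed.
Fact circle_mul_subproof a b : `|val a * val b| == 1.
Proof. by rewrite normrM !circle_norm mulr1. Qed.

Definition circle_one : circle R := exist _ 1 circle_one_subproof.
Definition circle_inv a : circle R := exist _ (val a)^-1 (circle_inv_subproof a).
Definition circle_mul a b : circle R :=
  exist _ (val a * val b) (circle_mul_subproof a b).

Fact circle_mulA : associative circle_mul.
Proof. by move=> a b c; apply/val_inj; rewrite /= mulrA. Qed.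
Fact circle_mul1 : left_id circle_one circle_mul.
Proof. by move=> a; apply/val_inj; rewrite /= mul1r. Qed.
Fact circle_1mul : right_id circle_one circle_mul.
Proof. by move=> a; apply/val_inj; rewrite /= mulr1. Qed.
Fact circle_mulV : left_inverse circle_one circle_inv circle_mul.
Proof. by move=> a; apply/val_inj; rewrite /= mulVf// circle_neq0. Qed.
Fact circle_Vmul : right_inverse circle_one circle_inv circle_mul.
Proof. by move=> a; apply/val_inj; rewrite /= mulfV// circle_neq0. Qed.

HB.instance Definition _ := isGroup.Build (circle R)
  circle_mulA circle_mul1 circle_1mul circle_mulV circle_Vmul.
HB.instance Definition _ := isPointed.Build (circle R) 1%g.

Lemma circle_mulC : commutative (fun a b => a * b)%g.
Proof. by move=> a b; apply/val_inj; rewrite /= mulrC. Qed.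

Lemma val_circleM a b : val (a * b)%g = val a * val b. Proof. by []. Qed.
Lemma val_circleV a : val (a^-1)%g = (val a)^-1. Proof. by []. Qed.
Lemma val_circle1 : val (1%g : circle R) = 1. Proof. by []. Qed.

End Circle.

Record bicharacter (R : realType) (G Gamma : zmodType) := Bicharacter {
  bichar :> Gamma -> G -> circle R;
  bicharDl : forall xi eta x, bichar (xi + eta) x = (bichar xi x * bichar eta x)%g;
  bicharDr : forall xi x y, bichar xi (x + y) = (bichar xi x * bichar xi y)%g
}.

(* The triple [(c, x, xi)] stands for c (x, xi). *)
Definition heisenberg (R : realType) (G Gamma : zmodType)
  (w : bicharacter R G Gamma) : Type := (circle R * G * Gamma)%type.

Section HeisenbergGroup.
Context {R : realType} {G Gamma : zmodType} (w : bicharacter R G Gamma).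
Local Notation H := (heisenberg w).

Lemma bichar0l x : w 0 x = 1%g.
Proof. by apply: (mulgI (w 0 x)); rewrite -bicharDl addr0 mulg1. Qed.
Lemma bichar0r xi : w xi 0 = 1%g.
Proof. by apply: (mulgI (w xi 0)); rewrite -bicharDr addr0 mulg1. Qed.
Lemma bicharNl xi x : w (- xi) x = (w xi x)^-1%g.
Proof. by apply: (mulgI (w xi x)); rewrite -bicharDl subrr bichar0l mulgV. Qed.
Lemma bicharNr xi x : w xi (- x) = (w xi x)^-1%g.
Proof. by apply: (mulgI (w xi x)); rewrite -bicharDr subrr bichar0r mulgV. Qed.

Definition heis_one : H := (1%g, 0, 0).
Definition heis_mul (g h : H) : H :=
  let: (c, x, xi) := g in let: (c', x', xi') := h in
  ((c * c' * w xi x')%g, x + x', xi + xi').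
Definition heis_inv (g : H) : H :=
  let: (c, x, xi) := g in ((c^-1 * w xi x)%g, - x, - xi).

Fact heis_mulA : associative heis_mul.
Proof.
move=> [[c x] xi] [[c' x'] xi'] [[c'' x''] xi''] /=; rewrite !addrA.
congr (_, _, _); rewrite bicharDl bicharDr; apply/val_inj => /=; ring.
Qed.
Fact heis_mul1 : left_id heis_one heis_mul.
Proof. by move=> [[c x] xi] /=; rewrite bichar0l mulg1 mul1g !add0r. Qed.
Fact heis_1mul : right_id heis_one heis_mul.
Proof. by move=> [[c x] xi] /=; rewrite bichar0r !mulg1 !addr0. Qed.
Fact heis_mulV : left_inverse heis_one heis_inv heis_mul.
Proof.
move=> [[c x] xi] /=; rewrite !addNr bicharNl.
by rewrite (circle_mulC _ c) mulgA mulgV mul1g mulgV.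
Qed.
Fact heis_Vmul : right_inverse heis_one heis_inv heis_mul.
Proof. by move=> [[c x] xi] /=; rewrite !subrr bicharNr mulgA mulgV mul1g mulgV. Qed.

HB.instance Definition _ := Choice.copy H (circle R * G * Gamma)%type.
HB.instance Definition _ := isGroup.Build H
  heis_mulA heis_mul1 heis_1mul heis_mulV heis_Vmul.

Definition torus (c : circle R) : H := (c, 0, 0).
Definition position (x : G) : H := (1%g, x, 0).
Definition momentum (xi : Gamma) : H := (1%g, 0, xi).

End HeisenbergGroup.

(* Commutative, not necessarily unital, associative algebra. *)
Record commutative_algebra (K : fieldType) (S : lmodType K)
    (mul : S -> S -> S) : Prop := {
  calg_mulA : associative mul;
  calg_mulC : commutative mul;
  calg_mulDl : left_distributive mul +%R;
  calg_scaleAl : forall (a : K) (s t : S), mul (a *: s) t = a *: mul s t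
}.

Record algebra_hom (K : fieldType) (S T : lmodType K)
    (mulS : S -> S -> S) (mulT : T -> T -> T) (f : S -> T) : Prop := {
  ahom_linear : linear f;
  ahom_mul : {morph f : s t / mulS s t >-> mulT s t}
}.

Section HeisenbergAlgebras.
Context {R : realType} {G Gamma : zmodType} (w : bicharacter R G Gamma).
Local Notation H := (heisenberg w).
Local Notation torus := (torus w).
Local Notation position := (position w).
Local Notation momentum := (momentum w).

Record left_heisenberg_algebra (S : lmodType R[i]) (mul : S -> S -> S)
    (act : H -> S -> S) : Prop := {
  lha_algebra : commutative_algebra mul;
  lha_act1 : forall s, act 1%g s = s;
  lha_actM : forall g h s, act (g * h)%g s = act g (act h s);
  lha_linear : forall h, linear (act h);
  lha_torus : forall c s, act (torus c) s = val c *: s;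
  lha_position : forall x s t,
    act (position x) (mul s t) = mul (act (position x) s) t;
  lha_momentum : forall xi s t,
    act (momentum xi) (mul s t) = mul (act (momentum xi) s) (act (momentum xi) t)
}.

Record right_heisenberg_algebra (S : lmodType R[i]) (mul : S -> S -> S)
    (act : S -> H -> S) : Prop := {
  rha_algebra : commutative_algebra mul;
  rha_act1 : forall s, act s 1%g = s;
  rha_actM : forall g h s, act s (g * h)%g = act (act s g) h;
  rha_linear : forall h, linear (act ^~ h);
  rha_torus : forall c s, act s (torus c) = val c *: s;
  rha_position : forall x s t,
    act (mul s t) (position x) = mul s (act t (position x));
  rha_momentum : forall xi s t,
    act (mul s t) (momentum xi) = mul (act s (momentum xi)) (act t (momentum xi))
}.

Record left_reversal (S : lmodType R[i]) (mul : S -> S -> S)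
    (act : H -> S -> S) (P : S -> S) : Prop := {
  lrev_hom : algebra_hom mul mul P;
  lrev_involutive : involutive P;
  lrev_position : forall x s, P (act (position x) s) = act (position (- x)) (P s);
  lrev_momentum : forall xi s,
    P (act (momentum xi) s) = act (momentum (- xi)) (P s)
}.

Record right_reversal (S : lmodType R[i]) (mul : S -> S -> S)
    (act : S -> H -> S) (P : S -> S) : Prop := {
  rrev_hom : algebra_hom mul mul P;
  rrev_involutive : involutive P;
  rrev_position : forall x s, P (act s (position x)) = act (P s) (position (- x));
  rrev_momentum : forall xi s,
    P (act s (momentum xi)) = act (P s) (momentum (- xi))
}.

Record fourier_operator (S T : lmodType R[i])
    (mulS : S -> S -> S) (actS : H -> S -> S)
    (mulT : T -> T -> T) (actT : T -> H -> T) (F : S -> T) : Prop := {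
  fop_hom : algebra_hom mulS mulT F;
  fop_position : forall x s, F (actS (position x) s) = actT (F s) (position x);
  fop_momentum : forall xi s,
    F (actS (momentum xi) s) = actT (F s) (momentum (- xi))
}.

Record fourier_doublet (S T : lmodType R[i])
    (mulS : S -> S -> S) (actS : H -> S -> S)
    (mulT : T -> T -> T) (actT : T -> H -> T) (F : S -> T) : Prop := {
  fd_left : left_heisenberg_algebra mulS actS;
  fd_right : right_heisenberg_algebra mulT actT;
  fd_operator : fourier_operator mulS actS mulT actT F
}.

Record fourier_doublet_with_reversals (S T : lmodType R[i])
    (mulS : S -> S -> S) (actS : H -> S -> S) (PS : S -> S)
    (mulT : T -> T -> T) (actT : T -> H -> T) (PT : T -> T)
    (F : S -> T) : Prop := {
  fdr_doublet : fourier_doublet mulS actS mulT actT F;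
  fdr_left : left_reversal mulS actS PS;
  fdr_right : right_reversal mulT actT PT;
  fdr_comm : forall s, F (PS s) = PT (F s)
}.

End HeisenbergAlgebras.

Record dual (R : realType) (G : topologicalZmodType) := Character {
  char_fun :> G -> circle R;
  char_continuous : continuous char_fun;
  charD : forall x y, char_fun (x + y) = (char_fun x * char_fun y)%g
}.

Section DualGroup.
Context {R : realType} {G : topologicalZmodType}.
Local Notation dual := (dual R G).
Implicit Types xi eta : dual.

HB.instance Definition _ := gen_eqMixin dual.
HB.instance Definition _ := gen_choiceMixin dual.

Lemma charP xi eta : xi =1 eta -> xi = eta.
Proof.
case: xi eta => [f cf fD] [g cg gD] /= /funext fg; subst g.
by congr Character; exact: Prop_irrelevance.
Qed.

Lemma continuous_circleP (T : topologicalType) (f : T -> circle R) :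
  continuous f <-> continuous (fun x => val (f x) : R[i]^o).
Proof.
split=> cf; last exact: (continuous_comp_initial cf).
by move=> x; apply: continuous_comp; [exact: cf|exact: initial_continuous].
Qed.

Definition char_zero_fun (_ : G) : circle R := 1%g.
Definition char_opp_fun xi (x : G) : circle R := (xi x)^-1%g.
Definition char_add_fun xi eta (x : G) : circle R := (xi x * eta x)%g.

Fact char_zero_continuous : continuous char_zero_fun.
Proof. exact: cst_continuous. Qed.
Fact char_zeroD x y :
  char_zero_fun (x + y) = (char_zero_fun x * char_zero_fun y)%g.
Proof. by rewrite /char_zero_fun mulg1. Qed.
Fact char_opp_continuous xi : continuous (char_opp_fun xi).
Proof.
apply/continuous_circleP => x; apply: (@cvgV (R[i]) _ _ _ (val \o xi)).
  exact: circle_neq0.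
exact: (iffLR (continuous_circleP _) (@char_continuous _ _ xi)).
Qed.
Fact char_oppD xi x y :
  char_opp_fun xi (x + y) = (char_opp_fun xi x * char_opp_fun xi y)%g.
Proof. by rewrite /char_opp_fun charD invgM circle_mulC. Qed.
Fact char_add_continuous xi eta : continuous (char_add_fun xi eta).
Proof.
apply/continuous_circleP => x.
apply: (@cvgM (R[i]) _ _ _ (val \o xi) (val \o eta));
  exact: (iffLR (continuous_circleP _) (@char_continuous _ _ _)).
Qed.
Fact char_addD xi eta x y :
  char_add_fun xi eta (x + y) = (char_add_fun xi eta x * char_add_fun xi eta y)%g.
Proof. by apply/val_inj; rewrite /= !charD /=; ring. Qed.

Definition char_zero := Character char_zero_continuous char_zeroD.
Definition char_opp xi := Character (@char_opp_continuous xi) (@char_oppD xi).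
Definition char_add xi eta :=
  Character (@char_add_continuous xi eta) (@char_addD xi eta).

Fact char_addA : associative char_add.
Proof. by move=> xi eta nu; apply/charP => x /=; exact: mulgA. Qed.
Fact char_addC : commutative char_add.
Proof. by move=> xi eta; apply/charP => x /=; exact: circle_mulC. Qed.
Fact char_add0 : left_id char_zero char_add.
Proof. by move=> xi; apply/charP => x /=; exact: mul1g. Qed.
Fact char_addN : left_inverse char_zero char_opp char_add.
Proof. by move=> xi; apply/charP => x /=; exact: mulVg. Qed.

HB.instance Definition _ := GRing.isZmodule.Build dual
  char_addA char_addC char_add0 char_addN.

HB.instance Definition _ := Topological.copy dual
  (initial_topology (@char_fun R G : dual -> {compact-open, G -> circle R})).

Lemma cvg_dualP (F : set_system dual) xi : Filter F ->
  F --> xi <-> forall (K : set G) (e : R[i]), compact K -> 0 < e ->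
    \forall eta \near F, forall x, K x -> `|val (xi x) - val ((eta : dual) x)| < e.
Proof.
move=> FF.
pose h : dual -> {compact-open, G -> circle R} := @char_fun R G.
have cxi := @char_continuous _ _ xi.
have step : F --> xi <-> {compact-open, h @ F --> (xi : G -> circle R)}.
  split=> [Fxi|hF].
    by move=> A /= /(@initial_continuous _ _ h xi); exact: Fxi.
  move=> A [_ [[B oB <-] Bxi BA]]; apply: (filterS BA).
  by apply: hF; apply: open_nbhs_nbhs.
have hFF : Filter ((h : dual -> G -> circle R) @ F) by exact: fmap_filter.
apply: (iff_trans step).
apply: (iff_trans (@compact_open_fam_compactP G (circle R) xi _ cxi hFF)).
apply: (iff_trans (fam_cvgP _ _ _)).
split=> [Fxi K e cK e0|Fxi K cK A].
  have := Fxi K cK [set g : G -> circle R |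
    forall y, K y -> `|val (xi y) - val (g y)| < e].
  apply; apply/uniform_nbhs.
  exists [set p : circle R * circle R | `|val p.1 - val p.2| < e]; split => //.
  exists [set p : R[i]^o * R[i]^o | `|p.1 - p.2| < e] => //.
  by rewrite -entourage_ballE; exists e.
move=> /uniform_nbhs[E [[E' + EE'] EA]].
rewrite -entourage_ballE => -[e /= e0 eE'].
apply: filterS (Fxi K e cK e0) => eta etaK.
by apply: EA => y Ky; apply: EE' => /=; apply: eE' => /=; exact: etaK.
Qed.

Fact dual_sub_continuous : continuous (fun p : dual * dual => p.1 - p.2).
Proof.
move=> [xi eta]; apply/cvg_dualP => K e cK e0 /=.
have e20 : 0 < e / 2 by rewrite divr_gt0.
have h1 := iffLR (cvg_dualP _ _) (@cvg_id _ (nbhs xi)) K _ cK e20.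
have h2 := iffLR (cvg_dualP _ _) (@cvg_id _ (nbhs eta)) K _ cK e20.
exists ([set nu : dual | forall x, K x -> `|val (xi x) - val (nu x)| < e / 2],
        [set nu : dual | forall x, K x -> `|val (eta x) - val (nu x)| < e / 2]).
  by split; [exact: h1|exact: h2].
move=> [xi' eta'] [/= h1' h2'] x Kx.
have u := circle_neq0 (eta x); have v := circle_neq0 (eta' x).
have -> : val (xi x) * (val (eta x))^-1 - val (xi' x) * (val (eta' x))^-1 =
  (val (xi x) - val (xi' x)) * (val (eta x))^-1
   - val (xi' x) * (val (eta x) - val (eta' x)) * (val (eta x))^-1 * (val (eta' x))^-1.
  by field; rewrite u v.
rewrite (le_lt_trans (ler_normB _ _))// !normrM !normfV !circle_norm.
by rewrite invr1 !mulr1 mul1r [ltRHS]splitr ltrD// ?h1' ?h2'.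
Qed.

HB.instance Definition _ :=
  PreTopologicalNmodule_isTopologicalZmodule.Build dual dual_sub_continuous.

Definition duality : bicharacter R G dual := @Bicharacter R G dual
  (fun xi x => xi x) (fun _ _ _ => erefl) (@charD R G).

End DualGroup.

Lemma addr_continuous (M : topologicalZmodType) (a : M) :
  continuous (fun x : M => x + a).
Proof.
move=> x; apply: (@continuous_comp _ _ _ (fun x => (x, a))
  (fun p : M * M => p.1 + p.2)); last exact: add_continuous.
by apply: cvg_pair; [exact: cvg_id|exact: cvg_cst].
Qed.

Definition vanishes_at_infinity (R : realType) (X : topologicalType)
    (f : X -> R[i]) :=
  forall e : R[i], 0 < e -> exists2 K, compact K & forall x, ~ K x -> `|f x| < e.

Definition C0_pred (R : realType) (X : topologicalType) : {pred X -> R[i]} :=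
  mem [set f : X -> R[i] | continuous (f : X -> R[i]^o) /\ vanishes_at_infinity f].
Arguments C0_pred : clear implicits.

Record C0 (R : realType) (X : topologicalType) := MkC0 {
  C0_fun :> X -> R[i];
  C0_funP : C0_fun \in C0_pred R X
}.

Section ContinuousVanishing.
Context {R : realType}.

Section Topological.
Context {X : topologicalType}.
Local Notation C0 := (C0 R X).
Local Notation C0_pred := (C0_pred R X).

HB.instance Definition _ := [isSub for @C0_fun R X].
HB.instance Definition _ := [Choice of C0 by <:].

Lemma C0_continuous (f : C0) : continuous (f : X -> R[i]^o).
Proof. by have := C0_funP f; rewrite inE => -[]. Qed.

Lemma C0_vanishes (f : C0) : vanishes_at_infinity f.
Proof. by have := C0_funP f; rewrite inE => -[]. Qed.

Lemma C0_ext (f g : C0) : f =1 g -> f = g.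
Proof. by move=> fg; apply/val_inj/funext. Qed.

Lemma vanishesM (f g : X -> R[i]) (M : R[i]) : (forall x, `|f x| <= M) ->
  vanishes_at_infinity g -> vanishes_at_infinity (fun x => f x * g x).
Proof.
move=> fM g0 e e0.
have M1 : 0 < `|M| + 1 by rewrite ltr_wpDl.
have [K cK gK] := g0 (e / (`|M| + 1)) (divr_gt0 e0 M1).
exists K => // x /gK gx; rewrite normrM.
have [->|f0] := eqVneq (f x) 0; first by rewrite normr0 mul0r.
have M0 : 0 <= M by exact: le_trans (fM x).
apply: (@le_lt_trans _ _ ((`|M| + 1) * `|g x|)).
  by rewrite ler_wpM2r// (le_trans (fM x))// (ger0_norm M0) lerDl.
by rewrite mulrC -ltr_pdivlMr.
Qed.

Fact C0_submod_closed : submod_closed C0_pred.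
Proof.
split; first rewrite inE; last move=> a f g; rewrite ?inE.
  split; first exact: cst_continuous.
  move=> e e0; exists set0; first exact: compact0.
  by move=> x _; rewrite normr0.
move=> -[cf f0] [cg g0]; split.
  by move=> x; apply: (@cvgD R[i] R[i]^o); [apply: cvgZr; exact: cf|exact: cg].
move=> e e0; have e20 : 0 < e / 2 by rewrite divr_gt0.
have [K cK afK] := @vanishesM (cst a) f `|a| (fun=> lexx _) f0 _ e20.
have [L cL gL] := g0 _ e20.
exists (K `|` L); first exact: compactU.
move=> x /not_orP[/afK fx /gL gx].
by rewrite (le_lt_trans (ler_normD _ _))// [ltRHS]splitr ltrD.
Qed.

HB.instance Definition _ :=
  GRing.isSubmodClosed.Build R[i] (X -> R[i]) C0_pred C0_submod_closed.
HB.instance Definition _ := [SubChoice_isSubLmodule of C0 by <:].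

Fact C0_mul_subproof (f g : C0) : (fun x => f x * g x) \in C0_pred.
Proof.
rewrite inE; split.
  by move=> x; apply: (@cvgM R[i]); exact: C0_continuous.
move=> e e0; have [K cK fK] := C0_vanishes f ltr01.
have [L cL gL] := C0_vanishes g e0.
exists (K `|` L); first exact: compactU.
move=> x /not_orP[/fK fx /gL gx]; rewrite normrM.
by rewrite (le_lt_trans _ gx)// ler_piMl// ltW.
Qed.
Definition C0_mul (f g : C0) : C0 := MkC0 (C0_mul_subproof f g).

Lemma C0_comp_subproof (f : C0) (h h' : X -> X) :
  continuous h -> continuous h' -> cancel h h' -> (f \o h) \in C0_pred.
Proof.
move=> ch ch' hK; rewrite inE; split.
  by move=> x; apply: continuous_comp; [exact: ch|exact: C0_continuous].
move=> e /(C0_vanishes f)[K cK fK]; exists (h' @` K).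
  by apply: continuous_compact => //; exact: continuous_subspaceT.
by move=> x Kx; apply: fK => Khx; apply: Kx; exists (h x).
Qed.

End Topological.

Section DualAction.
Context {G : topologicalZmodType}.
Local Notation Gamma := (dual R G).
Local Notation C0 := (C0 R Gamma).
Implicit Types (s : C0) (x : G) (xi eta : Gamma).

Fact C0_reversal_subproof s : (fun eta => s (- eta)) \in C0_pred R Gamma.
Proof.
exact: (@C0_comp_subproof Gamma s (fun eta => - eta) (fun eta => - eta)
  (@opp_continuous _) (@opp_continuous _) (@opprK _)).
Qed.
Definition C0_reversal s : C0 := MkC0 (C0_reversal_subproof s).

Fact C0_translation_subproof xi s :
  (fun eta => s (eta - xi)) \in C0_pred R Gamma.
Proof.
exact: (@C0_comp_subproof Gamma s (fun eta => eta - xi) (fun eta => eta + xi)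
  (@addr_continuous _ _) (@addr_continuous _ _) (subrK xi)).
Qed.
Definition C0_translation xi s : C0 := MkC0 (C0_translation_subproof xi s).

Lemma char_eval_continuous x :
  continuous (fun eta : Gamma => val (eta x) : R[i]^o).
Proof.
move=> eta; apply: (iffRL (@cvgrPdist_lt _ R[i]^o _ (nbhs eta) (nbhs_filter eta) _ _)) => e e0.
have := iffLR (@cvg_dualP _ _ _ eta (nbhs_filter eta)) (fun A h => h) [set x] e
  (@compact_set1 _ x) e0.
by apply: filterS => nu /(_ x erefl).
Qed.

Fact C0_modulation_subproof x s :
  (fun eta => val (duality eta x) * s eta) \in C0_pred R Gamma.
Proof.
rewrite inE; split; last first.
  apply: (@vanishesM _ _ _ 1); first by move=> eta; rewrite circle_norm.
  exact: C0_vanishes.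
move=> eta; apply: (@cvgM R[i] _ (nbhs eta) (nbhs_filter eta)).
  exact: char_eval_continuous.
exact: C0_continuous.
Qed.
Definition C0_modulation x s : C0 := MkC0 (C0_modulation_subproof x s).

(* c (x, xi) = c . x . xi, so a right action lets c act first, then x, then xi. *)
Definition C0_act s (h : heisenberg (@duality R G)) : C0 :=
  let: (c, x, xi) := h in C0_translation xi (C0_modulation x (val c *: s)).

End DualAction.
End ContinuousVanishing.

Section ComplexIntegral.
Context d (T : measurableType d) (R : realType).
Variable mu : {measure set T -> \bar R}.
Implicit Types f g : T -> R[i].

(* For measurable f this is the finiteness of the integral of |f|. *)
Definition cintegrable f :=
  mu.-integrable setT (EFin \o (fun x => complex.Re (f x))) /\
  mu.-integrable setT (EFin \o (fun x => complex.Im (f x))).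

Definition cintegral f : R[i] :=
  ((\int[mu]_x complex.Re (f x)) +i* (\int[mu]_x complex.Im (f x)))%C.

Definition L1_pred : {pred T -> R[i]} := mem [set f | cintegrable f].

Record L1_fun := MkL1 { L1_val :> T -> R[i]; L1_valP : L1_val \in L1_pred }.

HB.instance Definition _ := [isSub for L1_val].
HB.instance Definition _ := [Choice of L1_fun by <:].

Lemma L1_integrable (f : L1_fun) : cintegrable f.
Proof. by have := L1_valP f; rewrite inE. Qed.

Lemma cintegrable_submod_closed : submod_closed L1_pred.
Proof.
split=> [|a f g]; rewrite !inE.
  by split; exact: integrable0.
move=> [rf jf] [rg jg]; split.
  apply: (@eq_integrable _ _ _ _ _ measurableT
    ((fun x => (complex.Re a)%:E * (complex.Re (f x))%:E) \-
     (fun x => (complex.Im a)%:E * (complex.Im (f x))%:E) \+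
     (EFin \o (fun x => complex.Re (g x))))%E).
    move=> x _ /=; rewrite -!EFinM -EFinB -EFinD; congr EFin.
    have -> : (a *: f + g) x = a * f x + g x by [].
    by case: a (f x) (g x) => [? ?] [? ?] [? ?].
  by apply: integrableD => //; apply: integrableB => //; exact: integrableZl.
apply: (@eq_integrable _ _ _ _ _ measurableT
  ((fun x => (complex.Re a)%:E * (complex.Im (f x))%:E) \+
   (fun x => (complex.Im a)%:E * (complex.Re (f x))%:E) \+
   (EFin \o (fun x => complex.Im (g x))))%E).
  move=> x _ /=; rewrite -!EFinM -!EFinD; congr EFin.
  have -> : (a *: f + g) x = a * f x + g x by [].
  by case: a (f x) (g x) => [? ?] [? ?] [? ?].
by apply: integrableD => //; apply: integrableD => //; exact: integrableZl.
Qed.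

HB.instance Definition _ :=
  GRing.isSubmodClosed.Build R[i] (T -> R[i]) L1_pred cintegrable_submod_closed.
HB.instance Definition _ := [SubChoice_isSubLmodule of L1_fun by <:].

Definition L1_null : {pred L1_fun} :=
  mem [set f : L1_fun | {ae mu, forall x, f x = 0}].

Lemma L1_null_submod_closed : submod_closed L1_null.
Proof.
split=> [|a f g]; rewrite !inE.
  by apply: nearW => x.
move=> f0 g0; apply: filterS2 f0 g0 => x.
by rewrite /= !fctE => -> ->; rewrite scaler0 addr0.
Qed.

HB.instance Definition _ :=
  GRing.isSubmodClosed.Build R[i] L1_fun L1_null L1_null_submod_closed.

Definition L1 : Type := Quotient.quot L1_null.

Local Open Scope quotient_scope.

HB.instance Definition _ := Choice.on L1.
HB.instance Definition _ := EqQuotient.on L1.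
HB.instance Definition _ := GRing.Zmodule.on L1.

Definition L1_repr (s : L1) : L1_fun := repr s.
Definition L1_class (f : L1_fun) : L1 := \pi_L1 f.

Lemma L1_classP (f g : L1_fun) :
  L1_class f = L1_class g <-> {ae mu, forall x, f x = g x}.
Proof.
rewrite /L1_class; split=> [/eqP|fg].
  rewrite -Quotient.idealrBE inE; apply: filterS => x.
  by move=> /eqP; rewrite subr_eq0 => /eqP.
apply/eqP; rewrite -Quotient.idealrBE inE; apply: filterS fg => x fg.
by apply/eqP; rewrite subr_eq0; apply/eqP.
Qed.

Lemma L1_reprK (s : L1) : L1_class (L1_repr s) = s.
Proof. exact: reprK. Qed.

Definition L1_scale (a : R[i]) (s : L1) : L1 := L1_class (a *: L1_repr s).

Lemma L1_scale_class a (f : L1_fun) : L1_scale a (L1_class f) = L1_class (a *: f).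
Proof.
apply/L1_classP.
have /L1_classP := L1_reprK (L1_class f).
by apply: filterS => x; rewrite /= !fctE => ->.
Qed.

Lemma L1_classD (f g : L1_fun) : L1_class (f + g) = L1_class f + L1_class g.
Proof. by rewrite /L1_class !piE. Qed.

Fact L1_scaleA a b s : L1_scale a (L1_scale b s) = L1_scale (a * b) s.
Proof. by rewrite -(L1_reprK s) !L1_scale_class scalerA. Qed.
Fact L1_scale1 : left_id 1 L1_scale.
Proof. by move=> s; rewrite -(L1_reprK s) L1_scale_class scale1r. Qed.
Fact L1_scaleDr : right_distributive L1_scale +%R.
Proof.
move=> a s t; rewrite -(L1_reprK s) -(L1_reprK t) -L1_classD !L1_scale_class.
by rewrite scalerDr L1_classD.
Qed.
Fact L1_scaleDl s : {morph L1_scale^~ s : a b / a + b}.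
Proof.
by move=> a b; rewrite -(L1_reprK s) !L1_scale_class scalerDl L1_classD.
Qed.

HB.instance Definition _ := GRing.Zmodule_isLmodule.Build R[i] L1
  L1_scaleA L1_scale1 L1_scaleDr L1_scaleDl.

End ComplexIntegral.

Definition borel (G : topologicalZmodType) : Type := G.

HB.instance Definition _ (G : topologicalZmodType) :=
  GRing.Zmodule.on (borel G).
HB.instance Definition _ (G : topologicalZmodType) :=
  isPointed.Build (borel G) 0.

Fact borel_setC (G : topologicalZmodType) (A : set (borel G)) :
  <<s @open G >> A -> <<s @open G >> (~` A).
Proof. by move=> sA; rewrite -setTD; exact: sigma_algebraCD. Qed.

HB.instance Definition _ (G : topologicalZmodType) :=
  @isMeasurable.Build (sigma_display (@open G)) (borel G) <<s @open G >>
    (@sigma_algebra0 _ setT (@open G)) (@borel_setC G)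
    (@sigma_algebra_bigcup _ setT (@open G)).

(* A translation-invariant nonzero Radon measure. *)
Record haar_measure (R : realType) (G : topologicalZmodType) := HaarMeasure {
  haar :> {measure set (borel G) -> \bar R};
  haar_neq0 : haar setT != 0%E;
  haar_invariant : forall (x : G) (A : set (borel G)), measurable A ->
    haar [set x + a | a in A] = haar A;
  haar_compact : forall K : set G, compact K -> (haar K < +oo)%E;
  haar_outer_regular : forall A : set (borel G), measurable A ->
    haar A = ereal_inf [set haar U | U in [set U | open (U : set G) /\ A `<=` U]];
  haar_inner_regular : forall U : set G, open U ->
    haar U = ereal_sup [set haar K | K in [set K | compact (K : set G) /\ K `<=` U]]
}.

Section L1Action.
Context {R : realType} {G : topologicalZmodType} (mu : haar_measure R G).
Local Notation Gamma := (dual R G).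
Local Notation L1_fun := (L1_fun mu).
Local Notation L1 := (L1 mu).
Implicit Types (f : L1_fun) (s : L1) (x y : G) (xi : Gamma).

Lemma continuous_borel (h : G -> G) : continuous h ->
  measurable_fun setT (h : borel G -> borel G).
Proof.
move=> /continuousP ch; apply: (@measurability _ _ _ (borel G) _ _ (@open G) erefl).
by move=> _ [U oU <-]; rewrite setTI; apply: sub_sigma_algebra; exact: ch.
Qed.

Lemma continuous_borelR (h : G -> R) : continuous h ->
  measurable_fun setT (h : borel G -> R).
Proof.
move=> /continuousP ch; apply: (measurability _ (measurable_realfun.RGenOInfty.measurableE R)).
move=> _ [_ [a ->] <-]; rewrite setTI; apply: sub_sigma_algebra; apply: ch.
exact: interval_open.
Qed.

Lemma haar_integrable_shift (F : borel G -> \bar R) x :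
  mu.-integrable setT F -> mu.-integrable setT (fun y : borel G => F (y - x)).
Proof.
pose sh : borel G -> borel G := fun y => y - x.
have ms : measurable_fun setT sh.
  by apply: continuous_borel; exact: addr_continuous.
move=> /integrableP[mF iF]; apply/integrableP; split.
  exact: (measurableT_comp mF ms).
rewrite (le_lt_trans _ iF)// le_eqVlt; apply/orP; left; apply/eqP.
transitivity (\int[pushforward mu sh]_y `|F y|)%E.
  rewrite (@ge0_integral_pushforward _ _ _ _ _ sh ms mu setT (abse \o F))//.
  - exact: measurableT_comp.
  - by move=> y _; exact: abse_ge0.
apply: eq_measure_integral => A mA _.
rewrite /pushforward -(haar_invariant mu x mA); congr (mu _).
apply/seteqP; split=> [y /= Ay|_ [a Aa <-]] /=.
  by exists (sh y) => //; rewrite /sh addrC subrK.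
by rewrite /sh addrAC subrr add0r.
Qed.

Fact L1_translation_subproof x f : (fun y => f (y - x)) \in L1_pred mu.
Proof.
by rewrite inE; have [rf jf] := L1_integrable f; split;
  [exact: (haar_integrable_shift x rf)|exact: (haar_integrable_shift x jf)].
Qed.
Definition L1_translation x s : L1 :=
  L1_class (MkL1 (L1_translation_subproof x (L1_repr s))).

Lemma L1_translation_class x f :
  L1_translation x (L1_class f) = L1_class (MkL1 (L1_translation_subproof x f)).
Proof.
apply/L1_classP => /=.
have /L1_classP[N [mN N0 sN]] := L1_reprK (L1_class f).
have eqN : [set x + a | a in N] = (fun y : borel G => y - x) @^-1` N.
  apply/seteqP; split=> [_ [a Na <-]|y Ny] /=.
    by rewrite addrAC subrr add0r.
  by exists (y - x) => //; rewrite addrC subrK.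
exists ((fun y : borel G => y - x) @^-1` N); split.
- rewrite -[X in measurable X]setTI; apply: continuous_borel => //.
  exact: addr_continuous.
- by rewrite -eqN haar_invariant.
- by move=> y /= ny; apply: sN.
Qed.

Lemma Re_continuous : continuous (@complex.Re R : R[i]^o -> R).
Proof.
move=> z; apply: (iffRL (@cvgrPdist_lt _ R _ (nbhs (z : R[i]^o))
  (nbhs_filter (z : R[i]^o)) _ _)) => e e0.
have e0C : 0 < (e%:C)%C by rewrite ltcR.
have := iffLR (@cvgrPdist_lt _ R[i]^o _ (nbhs (z : R[i]^o))
  (nbhs_filter (z : R[i]^o)) id z) (fun A zA => zA) _ e0C.
apply: filterS => w; rewrite -ltcR; apply: le_lt_trans.
have -> : complex.Re z - complex.Re w = complex.Re (z - w).
  by case: z w => [? ?] [? ?].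
exact: normc_ge_Re.
Qed.

Lemma normc_ge_Im (z : R[i]) : (`|complex.Im z|%:C)%C <= `|z|.
Proof.
by case: z => a b; rewrite normc_def lecR -sqrtr_sqr ler_wsqrtr // lerDr sqr_ge0.
Qed.

Lemma Im_continuous : continuous (@complex.Im R : R[i]^o -> R).
Proof.
move=> z; apply: (iffRL (@cvgrPdist_lt _ R _ (nbhs (z : R[i]^o))
  (nbhs_filter (z : R[i]^o)) _ _)) => e e0.
have e0C : 0 < (e%:C)%C by rewrite ltcR.
have := iffLR (@cvgrPdist_lt _ R[i]^o _ (nbhs (z : R[i]^o))
  (nbhs_filter (z : R[i]^o)) id z) (fun A zA => zA) _ e0C.
apply: filterS => w; rewrite -ltcR; apply: le_lt_trans.
have -> : complex.Im z - complex.Im w = complex.Im (z - w).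
  by case: z w => [? ?] [? ?].
exact: normc_ge_Im.
Qed.

Lemma char_Re_Im xi :
  [/\ continuous (fun y => complex.Re (val (xi y))),
      continuous (fun y => complex.Im (val (xi y))),
      forall y, `|complex.Re (val (xi y))| <= 1 &
      forall y, `|complex.Im (val (xi y))| <= 1].
Proof.
have cxi := iffLR (continuous_circleP _) (@char_continuous _ _ xi).
split=> y.
- exact: (@continuous_comp G R[i]^o R _ (@complex.Re R) y (cxi y)
    (@Re_continuous _)).
- exact: (@continuous_comp G R[i]^o R _ (@complex.Im R) y (cxi y)
    (@Im_continuous _)).
- by rewrite -lecR -[leRHS](circle_norm (xi y)); exact: normc_ge_Re.
- by rewrite -lecR -[leRHS](circle_norm (xi y)); exact: normc_ge_Im.
Qed.

Fact L1_modulation_subproof xi f :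
  (fun y => val (xi y) * f y) \in L1_pred mu.
Proof.
rewrite inE; have [rf jf] := L1_integrable f.
have [cR cI bR bI] := char_Re_Im xi.
have mulint (h k : G -> R) : continuous h -> (forall y, `|h y| <= 1) ->
    mu.-integrable setT (EFin \o k : borel G -> \bar R) ->
    mu.-integrable setT
      ((EFin \o (h : borel G -> R)) \* (EFin \o (k : borel G -> R)))%E.
  move=> ch bh ik; apply: integrableMr => //; first exact: continuous_borelR.
  by exists 1; split=> // M M1 y _ /=; rewrite (le_trans (bh y))// ltW.
split.
  apply: (@eq_integrable _ _ _ _ _ measurableT _ _ _
    (integrableB measurableT (mulint _ _ cR bR rf) (mulint _ _ cI bI jf))).
  by move=> y _ /=; case: (val (xi y)) (f y) => [? ?] [? ?].
apply: (@eq_integrable _ _ _ _ _ measurableT _ _ _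
  (integrableD measurableT (mulint _ _ cR bR jf) (mulint _ _ cI bI rf))).
by move=> y _ /=; case: (val (xi y)) (f y) => [? ?] [? ?].
Qed.
Definition L1_modulation xi s : L1 :=
  L1_class (MkL1 (L1_modulation_subproof xi (L1_repr s))).

Lemma L1_modulation_class xi f :
  L1_modulation xi (L1_class f) = L1_class (MkL1 (L1_modulation_subproof xi f)).
Proof.
apply/L1_classP => /=; have /L1_classP := L1_reprK (L1_class f).
by apply: filterS => y /= ->.
Qed.

(* c (x, xi) = c . x . xi, so a left action lets xi act first, then x, then c. *)
Definition L1_act (h : heisenberg (@duality R G)) s : L1 :=
  let: (c, x, xi) := h in val c *: L1_translation x (L1_modulation xi s).

(* The next three predicates determine the operators they describe, since
   every element of [L1] is the class of an integrable function. *)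
Definition is_convolution (conv : L1 -> L1 -> L1) := forall f g : L1_fun,
  {ae mu, forall x, cintegrable mu (fun y => f y * g (x - y)) /\
    L1_repr (conv (L1_class f) (L1_class g)) x =
      cintegral mu (fun y => f y * g (x - y))}.

Definition is_L1_reversal (P : L1 -> L1) := forall f,
  {ae mu, forall y, L1_repr (P (L1_class f)) y = f (- y)}.

Definition is_fourier_transform (F : L1 -> C0 R Gamma) := forall f xi,
  F (L1_class f) xi = cintegral mu (fun y => val (xi y) * f y).

End L1Action.

(* Main.v *)
(* For non-metrizable G the Borel sets of G * G need not lie in the product
   sigma-algebra, so f(y) g(x - y) may fail to be product measurable.  By regularity
   of Haar measure every integrable function agrees almost everywhere with a Baire
   function vanishing off a sigma-compact subgroup H; Baire sets are generated by
   compact G_delta sets, whose preimages under subtraction are product measurable on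
   H * H, where Haar measure is sigma-finite and Fubini's theorem applies.  Fubini
   gives first the invariance of Haar measure under inversion, then the algebraic
   properties of convolution and the multiplicativity of the Fourier transform.

   By density, the Fourier transform of f vanishes at infinity as soon as this holds
   for indicators of compact sets K.  There
     |1 - xi x| |F(1_K)(xi)| <= 2 mu(K symmetric difference x + K)
   is small for x near 0, so where |F(1_K)| >= e the characters form an
   equicontinuous family, which is relatively compact in the dual. *)
Require Import Defs.
From HB Require Import structures.
From mathcomp Require Import all_boot all_order all_algebra.
From mathcomp Require Import all_classical all_reals all_analysis.
From mathcomp Require Import complex measurable_realfun ring lra.

Set Implicit Arguments.
Unset Strict Implicit.
Unset Printing Implicit Defensive.

Import Order.TTheory GRing.Theory Num.Theory.
Import numFieldNormedType.Exports.

Local Open Scope classical_set_scope.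
Local Open Scope ring_scope.

(** * Compact sets in topological groups *)

(** Convolution sees its factors through f(y) g(x - y), so replacing g by a Baire version is
    harmless only if the preimage of a null set under y -> x - y is null. Haar measure is given with
    translation invariance only; this is why inversion comes before every statement on convolution.
    Once it is available, the convolution of two classes is the same function at every x, whatever
    the representatives. A sigma-compact subgroup is taken rather than a sigma-compact set because
    the kernel must live on H * H: if y and x - y belong to H, so does x. Identities that split or
    rescale a convolution integral hold only at the points x where the slices are integrable, hence
    almost everywhere, which is all that equality of classes asks for. The Fourier transform
    involves a single integration, so its decay is proved with Borel sets and regularity alone.
    Product measures return only for multiplicativity: the integral of a convolution is the product
    of the integrals, applied to the functions modulated by a character. *)

(** The sets satisfying [P] are directed by inclusion, so their upper cones generate a filter.
    Near-covering compactness along this filter replaces the extraction of a finite subcover. *)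
Lemma compact_set_ind (T : topologicalType) (P : set T -> Prop) (K : set T) :
  P set0 -> (forall A B, P A -> P B -> P (A `|` B)) ->
  (forall A B, A `<=` B -> P B -> P A) ->
  compact K -> (forall x, K x -> exists2 U, nbhs x U & P U) -> P K.
Proof.
move=> P0 PU PS /compact_near_coveringP cK locP.
pose F := filter_from P (fun J0 => [set J | P J /\ J0 `<=` J]).
have FF : Filter F.
  apply: filter_from_filter => [|A B]; first by exists set0.
  move=> PA PB; exists (A `|` B); first exact: PU.
  by move=> J [PJ AJ]; split; split=> // x Hx; apply: AJ; [left|right].
have [x Kx|J0 PJ0 HJ] := cK _ F (fun J x => J x) FF.
  have [U xU PUx] := locP x Kx.
  exists (U, [set J | P J /\ U `<=` J]); first by split => //; exists U.
  by move=> [y J] /= [Uy [_ UJ]]; exact: UJ.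
by apply: (PS _ _ (HJ J0 (conj PJ0 (@subset_refl _ _))) PJ0).
Qed.

Section Topology.
Context {G : topologicalZmodType}.
Implicit Types (K L A B U V : set G).

Definition minkowski_sub A B : set G := [set p.1 - p.2 | p in A `*` B].
Definition minkowski_add A B : set G := [set p.1 + p.2 | p in A `*` B].

Lemma compact_minkowski_sub K L : compact K -> compact L ->
  compact (minkowski_sub K L).
Proof.
move=> cK cL; apply: continuous_compact; last exact: compact_setX.
by apply: continuous_subspaceT => p; exact: sub_continuous.
Qed.

Lemma compact_minkowski_add K L : compact K -> compact L ->
  compact (minkowski_add K L).
Proof.
move=> cK cL; apply: continuous_compact; last exact: compact_setX.
by apply: continuous_subspaceT => p; exact: add_continuous.
Qed.

Lemma translate_preimage (x : G) A :
  [set x + a | a in A] = (fun y => y - x) @^-1` A.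
Proof.
apply/seteqP; split=> [_ [a Aa <-] /=|y Ay]; first by rewrite addrAC subrr add0r.
by exists (y - x) => //; rewrite addrC subrK.
Qed.

Lemma oppr_preimage A : -%R @` A = -%R @^-1` A.
Proof.
apply/seteqP; split=> [_ [a Aa <-] /=|y Ay]; first by rewrite opprK.
by exists (- y) => //; rewrite opprK.
Qed.

Lemma open_translate (x : G) U : open U -> open [set x + u | u in U].
Proof.
move=> oU; rewrite translate_preimage.
by apply: open_comp => // y _; exact: addr_continuous.
Qed.

Lemma open_oppr U : open U -> open (-%R @` U).
Proof.
by move=> oU; rewrite oppr_preimage; apply: open_comp => // y _; exact: opp_continuous.
Qed.

Lemma compact_oppr K : compact K -> compact (-%R @` K).
Proof.
move=> cK; apply: continuous_compact => //; apply: continuous_subspaceT.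
exact: opp_continuous.
Qed.

Lemma compact_nbhs_add K U : compact K -> open U -> K `<=` U ->
  \forall v \near nbhs (0 : G), K `<=` (fun k => U (k + v)).
Proof.
move=> /compact_near_coveringP cK oU KU.
apply: (cK G (nbhs (0 : G)) (fun v k => U (k + v)) (nbhs_filter _)) => x Kx.
have := @add_continuous G (x, 0) U; rewrite /= addr0.
by apply; exact: (open_nbhs_nbhs (conj oU (KU _ Kx))).
Qed.

Lemma nbhs0_sub (V : set G) : nbhs 0 V ->
  exists2 W, nbhs (0 : G) W & forall a b, W a -> W b -> V (a - b).
Proof.
move=> V0; have := @sub_continuous G (0, 0) V; rewrite /= subr0.
move=> /(_ V0)[[W1 W2] [/= W10 W20] W12]; exists (W1 `&` W2); first exact: filterI.
by move=> a b [Wa _] [_ Wb]; exact: (W12 (a, b)).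
Qed.

(** Take V = K + W° with W - W so small that K + (W - W) lies in U. If p is in the closure of V,
    then p + W meets V, so p = k + w - w'. *)
Lemma compact_open_closure K U : compact K -> open U -> K `<=` U ->
  exists2 V, open V & K `<=` V /\ closure V `<=` U.
Proof.
move=> cK oU KU; have [W W0 WV] := nbhs0_sub (compact_nbhs_add cK oU KU).
pose V := \bigcup_(k in K) [set k + w | w in W°].
exists V; first by apply: bigcup_open => k _; exact/open_translate/open_interior.
split=> [k Kk|p clp].
  by exists k => //; exists 0; rewrite ?addr0//; exact: W0.
have pW : nbhs p [set p + w | w in W].
  rewrite translate_preimage; apply: (@addr_continuous G (- p) p).
  by rewrite /= subrr.
have [_ [[k Kk [w /interior_subset Ww <-]] [w' Ww' e]]] := clp _ pW.
suff -> : p = k + (w - w') by exact: WV.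
by rewrite addrA -e addrK.
Qed.

Hypothesis hausG : hausdorff_space G.
Hypothesis lcG : locally_compact [set: G].

Lemma nbhs0_compact : exists2 L : set G, compact L & nbhs 0 L.
Proof.
have [B BT [cB clB]] := lcG (x := 0) I.
exists B => //; move: BT; rewrite /globally/=; rewrite /within/=.
by apply: filterS => x; apply.
Qed.

Lemma compact_open_compact K U : compact K -> open U -> K `<=` U ->
  exists2 V, open V & [/\ K `<=` V, closure V `<=` U & compact (closure V)].
Proof.
move=> cK oU KU; have [L cL L0] := nbhs0_compact.
pose W := \bigcup_(k in K) [set k + w | w in L°].
have KW : K `<=` W.
  move=> k Kk; exists k => //; by exists 0; rewrite ?addr0.
have oW : open W by apply: bigcup_open => k _; exact/open_translate/open_interior.
have KUW : K `<=` U `&` W by move=> k Kk; split; [exact: KU|exact: KW].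
have [V oV [KV VU]] := compact_open_closure cK (openI oU oW) KUW.
exists V => //; split=> //; first by move=> x /VU[].
apply: (subclosed_compact _ (compact_minkowski_add cK cL)); first exact: closed_closure.
by move=> x /VU[_ [k Kk [l /interior_subset Ll <-]]]; exists (k, l).
Qed.

Definition compact_gdelta : set (set G) := [set C | compact C /\
  exists2 U : nat -> set G, forall n, open (U n) & C = \bigcap_n U n].

(** Starting from U, open sets containing K are chosen so that each has compact closure inside the
    previous one. Their intersection is a countable intersection of open sets by construction. *)
Lemma compact_gdelta_between K U : compact K -> open U -> K `<=` U ->
  exists2 C, compact_gdelta C & K `<=` C /\ C `<=` U.
Proof.
move=> cK oU KU.
pose S := {V : set G | open V /\ K `<=` V}.
have step (s : S) : {t : S | closure (sval t) `<=` sval s /\ compact (closure (sval t))}.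
  apply: cid; case: s => V [oV KV] /=.
  have [V' oV' [KV' V'V cV']] := compact_open_compact cK oV KV.
  by exists (exist _ V' (conj oV' KV')).
pose s0 : S := exist _ U (conj oU KU).
pose s n := iter n (fun s => sval (step s)) s0.
have sS n : closure (sval (s n.+1)) `<=` sval (s n) /\ compact (closure (sval (s n.+1))).
  exact: (svalP (step (s n))).
have sO n : open (sval (s n)) by case: (svalP (s n)).
have sK n : K `<=` sval (s n) by case: (svalP (s n)).
exists (\bigcap_n sval (s n)); last first.
  split; first by move=> x Kx n _; exact: sK.
  by move=> x /(_ 0%N I).
split; last by exists (fun n => sval (s n)).
(* Each closure lies in the preceding open set, so intersecting the closures gives the same set, now
   closed inside a compact one. *)
have -> : \bigcap_n sval (s n) = \bigcap_n closure (sval (s n.+1)).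
  apply/seteqP; split=> x xs n _; first by apply: subset_closure; exact: xs.
  by apply: (sS n).1; exact: xs.
apply: (subclosed_compact _ (sS 0%N).2); last by move=> x; exact.
by apply: closed_bigI => n _; exact: closed_closure.
Qed.

Lemma compact_measurable K : compact K -> measurable (K : set (borel G)).
Proof.
move=> /(compact_closed hausG) cK; rewrite -(setCK K); apply: measurableC.
by apply: sub_sigma_algebra; rewrite openC.
Qed.

Lemma open_measurable_borel U : open U -> measurable (U : set (borel G)).
Proof. exact: sub_sigma_algebra. Qed.

(** Stage n + 1 adds all differences of stage n. Keeping 0 in every stage makes the stages increase,
    so two elements of the union always meet in a common stage, and their difference is in the
    next. *)
Lemma sigma_compact_subgroup (A : nat -> set G) : (forall n, compact (A n)) ->
  exists K : nat -> set G, [/\ forall n, compact (K n),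
    forall n, A n `<=` \bigcup_n K n, (\bigcup_n K n) 0 &
    forall x y, (\bigcup_n K n) x -> (\bigcup_n K n) y -> (\bigcup_n K n) (x - y)].
Proof.
move=> cA.
pose M := fix M n := let P := if n is m.+1 then minkowski_sub (M m) (M m) else set0 in
  P `|` (A n `|` [set 0]).
have cM n : compact (M n).
  elim: n => [|n IH] /=; (apply: compactU; last by apply: compactU => //; exact: compact_set1).
    exact: compact0.
  exact: compact_minkowski_sub.
have M0 n : M n 0 by case: n => [|n]; right; right.
have MS n : M n `<=` M n.+1.
  by move=> x Mx; left; exists (x, 0) => //=; rewrite subr0.
have Mle m n : (m <= n)%N -> M m `<=` M n.
  elim: n => [|n IH]; first by rewrite leqn0 => /eqP->.
  by rewrite leq_eqVlt => /predU1P[->//|/IH h x /h/MS].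
exists M; split=> //.
- by move=> n x Ax; exists n => //; case: n Ax => [|n] Ax; right; left.
- by exists 0%N.
move=> x y [n _ Mx] [m _ My]; exists (maxn n m).+1 => //; left.
by exists (x, y) => //; split; [exact: (Mle _ _ (leq_maxl n m))|exact: (Mle _ _ (leq_maxr n m))].
Qed.

End Topology.

(** * Regularity of Haar measure and the Baire sigma-algebra *)

Section Regularity.
Context {R : realType} {G : topologicalZmodType} (mu : haar_measure R G).
Hypothesis hausG : hausdorff_space G.
Implicit Types (K L U V E : set (borel G)).

Local Open Scope ereal_scope.

Lemma haar_open_approx E (e : R) : measurable E -> mu E < +oo -> (0 < e)%R ->
  exists2 U, open (U : set G) & [/\ E `<=` U, mu U < +oo & mu (U `\` E) < e%:E].
Proof.
move=> mE Eoo e0; have Efin : mu E \is a fin_num by rewrite ge0_fin_numE.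
have := haar_outer_regular mu mE => eqE.
have [_ [U [oU EU] <-]] := lb_ereal_inf_adherent e0 (eq_ind _ (fun x => x \is a fin_num) Efin _ eqE).
rewrite -eqE => Ue; have mU := open_measurable_borel oU.
exists U => //; split=> //.
  by rewrite (lt_trans Ue)// lte_add_pinfty// ltry.
rewrite measureD//; last by rewrite (lt_trans Ue)// lte_add_pinfty// ltry.
by rewrite setIidr// lteBlDr// addeC.
Qed.

(** Inner regularity is given for open sets only. A compact L is therefore taken inside an open U
    around E, and an open W covering the excess U - E is removed from it: L - W is still compact and
    now lies in E. The loss is at most mu(U - L) + mu(W), where mu(U - L) < e/3 and mu(W) < 2e/3. *)
Lemma haar_regular E (e : R) : measurable E -> mu E < +oo -> (0 < e)%R ->
  exists K U, [/\ compact (K : set G), open (U : set G), K `<=` E, E `<=` U &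
    mu (U `\` K) < e%:E].
Proof.
move=> mE Eoo e0; have e30 : (0 < e / 3)%R by rewrite divr_gt0.
have [U oU [EU Uoo UE]] := haar_open_approx mE Eoo e30.
have mU := open_measurable_borel oU.
have [W oW [UEW Woo WUE]] := haar_open_approx (measurableD mU mE)
  (le_lt_trans (le_measure mu (mem_set (measurableD mU mE)) (mem_set mU) (@subDsetl _ _ _)) Uoo) e30.
have mW := open_measurable_borel oW.
have Ufin : mu U \is a fin_num by rewrite ge0_fin_numE.
have eqU := haar_inner_regular mu oU.
have [_ [L [cL LU] <-]] := ub_ereal_sup_adherent e30
  (eq_ind _ (fun x => x \is a fin_num) Ufin _ eqU).
rewrite -eqU => Le; have mL := compact_measurable hausG cL.
exists (L `\` W), U; split => //.
- apply: (@subclosed_compact G _ L) => //.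
  by apply: closedI; [exact: compact_closed|rewrite closedC].
- by move=> x [Lx Wx]; apply: contrapT => nEx; apply: Wx; apply: UEW; split=> //; exact: LU.
have -> : U `\` (L `\` W) = (U `\` L) `|` (U `&` W) by rewrite setDDr.
have mUL : mu (U `\` L) < (e / 3)%:E.
  have Lfin : mu L \is a fin_num by rewrite ge0_fin_numE// (haar_compact mu cL).
  by rewrite measureD// setIidr//; move: Le; rewrite !lteBlDr// addeC.
have mWe : mu W < (e / 3 + e / 3)%:E.
  have -> : W = (W `\` (U `\` E)) `|` (U `\` E).
    by rewrite setUC setDUK.
  have mUE := measurableD mU mE; have mWUE := measurableD mW mUE.
  by rewrite EFinD (le_lt_trans (measureU2 mu mWUE mUE))// lteD.
rewrite (le_lt_trans (measureU2 mu (measurableD mU mL) (measurableI _ _ mU mW)))//.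
have -> : e%:E = (e / 3)%:E + (e / 3 + e / 3)%:E.
  by rewrite -EFinD; congr EFin; field.
rewrite lteD// (le_lt_trans _ mWe)// le_measure ?inE//; exact: measurableI.
Qed.

End Regularity.

(** By compactness a finite union of open rectangles fits between D and W, and open rectangles are
    measurable for the product sigma-algebra even when general open sets are not. *)
Lemma compact_open_prod_measurable (G : topologicalZmodType) (D W : set (G * G)) :
  compact D -> open W -> D `<=` W ->
  exists2 E : set (borel G * borel G), measurable E & D `<=` E /\ E `<=` W.
Proof.
move=> cD oW DW; pose P J := exists2 E : set (borel G * borel G),
  measurable E & J `<=` E /\ E `<=` W.
apply: (compact_set_ind (P := P)) => //.
- by exists set0 => //; split=> // x [].
- move=> A B [E mE [AE EW]] [F mF [BF FW]]; exists (E `|` F); first exact: measurableU.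
  by split=> x [Hx|Hx]; [left; exact: AE|right; exact: BF|exact: EW|exact: FW].
- by move=> A B AB [E mE [BE EW]]; exists E => //; split=> // x /AB/BE.
move=> [x y] Dxy; have [[A B] [/= Ax By] ABW] := open_nbhs_nbhs (conj oW (DW _ Dxy)).
have ABW' : A° `*` B° `<=` W.
  by move=> z [/interior_subset Az /interior_subset Bz]; exact: ABW.
exists (A° `*` B°).
  by exists (A°, B°) => //; split => /=; [exact: (nbhs_interior Ax)|exact: (nbhs_interior By)].
exists (A° `*` B°); last by split.
by apply: measurableX; exact: (open_measurable_borel (@open_interior G _)).
Qed.

Definition baire (G : topologicalZmodType) :=
  g_sigma_algebraType (@compact_gdelta G : set (set (borel G))).

Section Baire.
Context {G : topologicalZmodType}.
Hypothesis hausG : hausdorff_space G.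

Lemma measurable_baire_borel (B : set G) :
  measurable (B : set (baire G)) -> measurable (B : set (borel G)).
Proof.
rewrite /measurable /=; apply: smallest_sub; first exact: sigma_algebra_measurable.
by move=> C [cC _]; exact: compact_measurable.
Qed.

Lemma baire_measurable_fun d (T : measurableType d) (f : G -> T) :
  measurable_fun setT (f : baire G -> T) -> measurable_fun setT (f : borel G -> T).
Proof.
by move=> mf _ B mB; apply: measurable_baire_borel; exact: mf.
Qed.

(* The Borel sigma-algebra of [G * G] can be larger than the product of the
   Borel sigma-algebras of [G]; on Baire sets the difference disappears. *)
Lemma continuous_baire_measurable (phi : G * G -> G) (K : nat -> set G) :
  continuous phi -> (forall n, compact (K n)) ->
  @measurable_fun _ _ (borel G * borel G)%type (baire G)
    ((\bigcup_n K n) `*` (\bigcup_n K n)) phi.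
Proof.
move=> cphi cK; apply: (@measurability _ _ _ (baire G) _ _ (@compact_gdelta G) erefl).
move=> _ [C [cC [U oU CU]] <-].
rewrite (_ : _ `&` _ =
  \bigcup_i \bigcup_j ((K i `*` K j) `&` phi @^-1` C)); last first.
  apply/seteqP; split=> [[x y] [[/= [i _ Kx] [j _ Ky]] Cxy]|[x y] [i _ [j _ [[/= Kx Ky] Cxy]]]].
    by exists i => //; exists j.
  by split=> //; split; [exists i|exists j].
apply: bigcup_measurable => i _; apply: bigcup_measurable => j _.
pose D := (K i `*` K j) `&` phi @^-1` C.
have cD : compact D.
  apply: compact_closedI; first exact: compact_setX.
  by apply: preimage_closed => //; exact: compact_closed.
(* The compact [D] and each open preimage of [U n] are separated by a product measurable set; inside
   the compact rectangle the intersection of these sets is exactly the preimage of [C]. *)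
have /choice[E HE] n : exists E : set (borel G * borel G),
    measurable E /\ (D `<=` E /\ E `<=` phi @^-1` (U n)).
  have oUn : open (phi @^-1` (U n)) by apply: open_comp => // x _; exact: cphi.
  have [|E mE HE] := compact_open_prod_measurable cD oUn; last by exists E.
  by move=> x [_]; rewrite /= CU => /(_ n I).
rewrite (_ : _ `&` _ = (K i `*` K j) `&` \bigcap_n E n); last first.
  apply/seteqP; split=> x [Kx Cx]; split=> //.
    by move=> n _; apply: (HE n).2.1.
  by rewrite /= CU => n _; apply: (HE n).2.2; exact: Cx.
apply: measurableI; first by apply: measurableX; exact: compact_measurable.
by apply: bigcap_measurable => // n _; exact: (HE n).1.
Qed.

End Baire.

(** * Complex-valued integrals *)

Section ComplexAbs.
Context {R : realType}.
Implicit Types z w : R[i].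

(* The norm |Re z| + |Im z| is equivalent to the modulus, submultiplicative,
   and keeps real and imaginary parts apart. *)
Definition cabs z : R := `|complex.Re z| + `|complex.Im z|.

Lemma cabs_ge0 z : 0 <= cabs z. Proof. by rewrite addr_ge0. Qed.
Lemma cabs0 : cabs 0 = 0. Proof. by rewrite /cabs normr0 addr0. Qed.

Lemma cabsM z w : cabs (z * w) <= cabs z * cabs w.
Proof.
case: z w => [a b] [c d]; rewrite /cabs /= mulrDl !mulrDr -!normrM.
apply: le_trans (lerD (ler_normB _ _) (ler_normD _ _)) _.
by rewrite le_eqVlt; apply/orP; left; apply/eqP; ring.
Qed.

Lemma normc_le_cabs z : `|z| <= (cabs z)%:C%C.
Proof.
case: z => a b; rewrite normc_def lecR /cabs /=.
rewrite -[leRHS]ger0_norm ?addr_ge0// -sqrtr_sqr ler_wsqrtr//.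
rewrite sqrrD !real_normK ?num_real//.
by have := mulr_ge0 (normr_ge0 a) (normr_ge0 b); lra.
Qed.

Lemma cabs_le_normc z : (cabs z)%:C%C <= 2 * `|z|.
Proof.
have -> : (cabs z)%:C%C = `|complex.Re z|%:C%C + `|complex.Im z|%:C%C :> R[i].
  by rewrite -rmorphD.
by rewrite mulr_natl mulr2n lerD ?normc_ge_Re ?normc_ge_Im.
Qed.

Lemma ReM z w : complex.Re (z * w) =
  complex.Re z * complex.Re w - complex.Im z * complex.Im w.
Proof. by case: z w => [? ?] [? ?]. Qed.
Lemma ImM z w : complex.Im (z * w) =
  complex.Re z * complex.Im w + complex.Im z * complex.Re w.
Proof. by case: z w => [? ?] [? ?]. Qed.

End ComplexAbs.

Definition cmeasurable d (T : measurableType d) (R : realType) (f : T -> R[i]) :=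
  measurable_fun setT (fun x => complex.Re (f x)) /\ measurable_fun setT (fun x => complex.Im (f x)).

Section CMeasurable.
Context d (T : measurableType d) (R : realType).
Implicit Types f g : T -> R[i].

Lemma cmeasurableM f g : cmeasurable f -> cmeasurable g ->
  cmeasurable (fun x => f x * g x).
Proof.
move=> [rf jf] [rg jg]; split.
  rewrite (_ : (fun _ => _) = ((fun x => complex.Re (f x)) \* (fun x => complex.Re (g x))) \-
    ((fun x => complex.Im (f x)) \* (fun x => complex.Im (g x))))%R; last first.
    by apply/funext => x /=; exact: ReM.
  by apply: measurable_funB; exact: measurable_funM.
rewrite (_ : (fun _ => _) = ((fun x => complex.Re (f x)) \* (fun x => complex.Im (g x))) \+
    ((fun x => complex.Im (f x)) \* (fun x => complex.Re (g x))))%R; last first.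
  by apply/funext => x /=; exact: ImM.
by apply: measurable_funD; exact: measurable_funM.
Qed.

Lemma measurable_cabs f : cmeasurable f -> measurable_fun setT (fun x => (cabs (f x))%:E).
Proof.
move=> [rf jf]; apply/measurable_EFinP; apply: measurable_funD.
  exact: (measurableT_comp (@normr_measurable _ _) rf).
exact: (measurableT_comp (@normr_measurable _ _) jf).
Qed.

Lemma cmeasurable_comp d' (T' : measurableType d') (h : T' -> T) f :
  cmeasurable f -> measurable_fun setT h -> cmeasurable (f \o h).
Proof.
by move=> [rf jf] mh; split; [exact: (measurableT_comp rf mh)|exact: (measurableT_comp jf mh)].
Qed.

Variable mu : {measure set T -> \bar R}.

Lemma cintegrableP f : cintegrable mu f <->
  cmeasurable f /\ (\int[mu]_x (cabs (f x))%:E < +oo)%E.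
Proof.
split=> [[rf jf]|[[rf jf] foo]].
  have mf : cmeasurable f.
    by split; apply/measurable_EFinP; [exact: measurable_int rf|exact: measurable_int jf].
  split=> //.
  have := integrableD measurableT (integrable_abse rf) (integrable_abse jf).
  move=> /integrableP[_]; congr (_ < _)%E; apply: eq_integral => x _ /=.
  by rewrite ger0_norm ?addr_ge0.
have mf : cmeasurable f by [].
split; apply/integrableP; (split; first exact/measurable_EFinP);
  apply: le_lt_trans foo; apply: ge0_le_integral => //.
- by apply/measurable_EFinP; apply: (measurableT_comp (@normr_measurable _ _) rf).
- exact: measurable_cabs.
- by move=> x _; rewrite lee_fin /cabs lerDl.
- by apply/measurable_EFinP; apply: (measurableT_comp (@normr_measurable _ _) jf).
- exact: measurable_cabs.
- by move=> x _; rewrite lee_fin /cabs lerDr.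
Qed.

Lemma cintegrable_cmeasurable f : cintegrable mu f -> cmeasurable f.
Proof. by move=> /cintegrableP[]. Qed.

Lemma cintegralD f g : cintegrable mu f -> cintegrable mu g ->
  cintegral mu (fun x => f x + g x) = cintegral mu f + cintegral mu g.
Proof.
move=> [rf jf] [rg jg]; rewrite /cintegral.
have -> : (fun x => complex.Re (f x + g x)) = (fun x => complex.Re (f x) + complex.Re (g x)).
  by apply/funext => x; case: (f x) (g x) => [? ?] [? ?].
have -> : (fun x => complex.Im (f x + g x)) = (fun x => complex.Im (f x) + complex.Im (g x)).
  by apply/funext => x; case: (f x) (g x) => [? ?] [? ?].
by rewrite !RintegralD//.
Qed.

Lemma cintegralZ a f : cintegrable mu f ->
  cintegral mu (fun x => a * f x) = a * cintegral mu f.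
Proof.
move=> [rf jf]; rewrite /cintegral; case: a => a b.
have -> : (fun x => complex.Re (a +i* b * f x)%C) =
    (fun x => a * complex.Re (f x) - b * complex.Im (f x)).
  by apply/funext => x; case: (f x) => [? ?].
have -> : (fun x => complex.Im (a +i* b * f x)%C) =
    (fun x => a * complex.Im (f x) + b * complex.Re (f x)).
  by apply/funext => x; case: (f x) => [? ?].
have iZ c (h : T -> R) : mu.-integrable setT (EFin \o h) ->
    mu.-integrable setT (EFin \o (fun x => c * h x)).
  by move=> /(integrableZl measurableT c); apply: eq_integrable => // x _.
by rewrite RintegralB ?RintegralD ?RintegralZl//; apply: iZ.
Qed.

Lemma ae_eq_cintegral f g : cmeasurable f -> cmeasurable g ->
  {ae mu, forall x, f x = g x} -> cintegral mu f = cintegral mu g.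
Proof.
move=> [rf jf] [rg jg] fg; rewrite /cintegral /Rintegral; congr (fine _ +i* fine _)%C.
  apply: ae_eq_integral => //; [exact/measurable_EFinP|exact/measurable_EFinP|].
  by apply: filterS fg => x /= ->.
apply: ae_eq_integral => //; [exact/measurable_EFinP|exact/measurable_EFinP|].
by apply: filterS fg => x /= ->.
Qed.

Lemma ae_eq_cintegrable f g : cmeasurable f -> cmeasurable g ->
  {ae mu, forall x, f x = g x} -> cintegrable mu f -> cintegrable mu g.
Proof.
move=> mf mg fg /cintegrableP[_ foo]; apply/cintegrableP; split=> //.
rewrite (_ : integral _ _ _ = (\int[mu]_x (cabs (f x))%:E)%E)//.
apply: ae_eq_integral => //; [exact: measurable_cabs|exact: measurable_cabs|].
by apply: filterS fg => x /= ->.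
Qed.

Lemma cabs_cintegral f : cintegrable mu f ->
  ((cabs (cintegral mu f))%:E <= \int[mu]_x (cabs (f x))%:E)%E.
Proof.
move=> [rf jf]; rewrite /cabs /cintegral /= EFinD.
under eq_integral do rewrite EFinD.
rewrite ge0_integralD//; last 2 first.
- by apply: (measurable_int mu); exact: integrable_abse rf.
- by apply: (measurable_int mu); exact: integrable_abse jf.
apply: leeD; rewrite EFin_normr_Rintegral//; apply: le_abse_integral => //.
  exact: measurable_int rf.
exact: measurable_int jf.
Qed.

End CMeasurable.

(** Real-valued iterated integrals apply [fine] to the inner integral. Integrable functions are
    finite almost everywhere, so this changes the inner integral only on a null set. *)
Lemma fine_integral_integrable d (T : measurableType d) (R : realType)
    (m : {measure set T -> \bar R}) (F : T -> \bar R) :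
  m.-integrable setT F -> m.-integrable setT (EFin \o (fun x => fine (F x))) /\
  (\int[m]_x (fine (F x))%:E = \int[m]_x F x)%E.
Proof.
move=> iF; have mF := measurable_int m iF.
have mfF : measurable_fun setT (fun x => (fine (F x))%:E).
  by apply/measurable_EFinP; apply: measurableT_comp.
split.
  apply: (le_integrable _ _ _ iF) => // x _ /=.
  by case: (F x) => [r| |] //=; rewrite normr0 leey.
apply: ae_eq_integral => //.
have := integrable_ae measurableT iF.
by apply: filterS => x /(_ I) Fx _; rewrite fineK.
Qed.

Section CFubini.
Context d1 d2 (T1 : measurableType d1) (T2 : measurableType d2) (R : realType).
Variables (m1 : {sigma_finite_measure set T1 -> \bar R})
          (m2 : {sigma_finite_measure set T2 -> \bar R}).

Lemma Fubini_Rintegral (k : T1 * T2 -> R) :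
  (m1 \x m2)%E.-integrable setT (EFin \o k) ->
  [/\ {ae m1, forall x, m2.-integrable setT (EFin \o (fun y => k (x, y)))},
      m1.-integrable setT (EFin \o (fun x => \int[m2]_y k (x, y))%R) &
      (\int[m1]_x \int[m2]_y k (x, y) = \int[m2]_y \int[m1]_x k (x, y))%R].
Proof.
move=> ik; split; first exact: ae_integrable1 ik.
  exact: (fine_integral_integrable (integrable_fubini_F ik)).1.
have [_ e1] := fine_integral_integrable (integrable_fubini_F ik).
(* Removing [fine] from the other iterated integral requires integrability of the swapped kernel,
   which Tonelli's criterion provides. *)
have ik' : (m2 \x m1)%E.-integrable setT (fun p : T2 * T1 => (k (p.2, p.1))%:E).
  have mk := measurable_int _ ik.
  apply/integrable12ltyP; first exact: (measurableT_comp mk (@measurable_swap _ _ _ _)).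
  by apply/(integrable21ltyP _ _ mk).
have [_ e2] := fine_integral_integrable (integrable_fubini_F ik').
by rewrite /Rintegral; congr fine; rewrite e1 e2; exact: Fubini.
Qed.

Lemma Fubini_cintegral (k : T1 * T2 -> R[i]) : cmeasurable k ->
  (\int[m1]_x \int[m2]_y (cabs (k (x, y)))%:E < +oo)%E ->
  [/\ {ae m1, forall x, cintegrable m2 (fun y => k (x, y))},
      cintegrable m1 (fun x => cintegral m2 (fun y => k (x, y))) &
      cintegral m1 (fun x => cintegral m2 (fun y => k (x, y))) =
      cintegral m2 (fun y => cintegral m1 (fun x => k (x, y)))].
Proof.
move=> mk koo; have [ik jk] : cintegrable (m1 \x m2)%E k.
  apply/cintegrableP; split=> //; rewrite fubini_tonelli1//.
    exact: measurable_cabs.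
  by move=> z; rewrite lee_fin cabs_ge0.
have [a1 i1 e1] := Fubini_Rintegral ik; have [a2 i2 e2] := Fubini_Rintegral jk.
split; [|by split|by rewrite /cintegral /= e1 e2].
by apply: filterS2 a1 a2 => x.
Qed.

End CFubini.

(** * Baire versions of integrable functions *)

(** Markov's inequality: a level set of infinite measure would make the integral of |h| infinite. It
    brings the level sets of an integrable function within reach of [haar_regular]. *)
Lemma integrable_level_lty d (T : measurableType d) (R : realType)
    (m : {measure set T -> \bar R}) (h : T -> R) (a : R) :
  m.-integrable setT (EFin \o h) -> 0 < a ->
  measurable [set x | a <= `|h x|] /\ (m [set x | (a <= `|h x|)%R] < +oo)%E.
Proof.
move=> ih a0; have mh := measurable_int m ih; split.
  rewrite (_ : [set x | _] = setT `&` [set x | (a%:E <= `|(EFin \o h) x|)%E]).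
    by apply: emeasurable_fun_c_infty => //; exact: measurableT_comp.
  by rewrite setTI.
have := @le_integral_comp_abse _ _ _ m _ measurableT (EFin \o h) a id
  (@measurable_id _ _ _) (fun _ h => h) _ mh a0.
move=> /(_ (fun _ _ _ _ h => h)); move/integrableP: ih => [_ hoo] /le_lt_trans/(_ hoo).
rewrite setTI => {}hoo; rewrite ltey; apply/eqP => e; move: hoo.
by rewrite [X in (_ * X)%E]e gt0_muley ?ltxx// lte_fin.
Qed.

Section BaireApproximation.
Context {R : realType} {G : topologicalZmodType} (mu : haar_measure R G).
Hypothesis hausG : hausdorff_space G.
Hypothesis lcG : locally_compact [set: G].

Local Open Scope ereal_scope.

(* If K_n <= C_n <= U_n squeeze E with mu(U_n - K_n) summable, Borel-Cantelli makes
   limsup C_n equal to E almost everywhere. *)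
Lemma ae_baire_set (E : set (borel G)) : measurable E -> mu E < +oo ->
  exists B (K : nat -> set G), [/\ measurable (B : set (baire G)),
    forall n, compact (K n), B `<=` \bigcup_n K n &
    {ae mu, forall x, E x <-> B x}].
Proof.
move=> mE Eoo.
have /choice[C HC] n : exists C, compact_gdelta C /\ exists K U,
    [/\ compact (K : set G), open (U : set G), K `<=` E, E `<=` U &
        [/\ K `<=` C, C `<=` U & mu (U `\` K) < (1 / (2 ^ n.+1)%:R)%:E]].
  have e0 : (0 < 1 / (2 ^ n.+1)%:R :> R)%R by rewrite divr_gt0// ltr0n expn_gt0.
  have [K [U [cK oU KE EU UK]]] := haar_regular hausG mE Eoo e0.
  have [C gC [KC CU]] := compact_gdelta_between lcG cK oU (subset_trans KE EU).
  by exists C; split=> //; exists K, U.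
have /choice[K HK] n := (HC n).2; have /choice[U HU] n := HK n.
have mK n : measurable (K n : set (borel G)).
  by apply: compact_measurable => //; case: (HU n).
have mU n : measurable (U n : set (borel G)).
  by apply: open_measurable_borel; case: (HU n).
pose F n : set (borel G) := U n `\` K n.
have mF n : measurable (F n) by exact: measurableD.
exists (lim_sup_set C), C; split.
- apply: bigcap_measurable => // n _; apply: bigcup_measurable => k _.
  by apply: sub_sigma_algebra; exact: (HC k).1.
- by move=> n; case: (HC n) => -[].
- by move=> x /(_ 0%N I)[k _ Ck]; exists k.
exists (lim_sup_set F); split.
- by apply: bigcap_measurable => // n _; apply: bigcup_measurable.
- apply: lim_sup_set_cvg0 => //.
  apply: (@le_lt_trans _ _ (1%:E)); last by rewrite ltry.
  apply: le_trans (epsilon_trick0 xpredT ler01).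
  apply: lee_nneseries => // n _; last by case: (HU n) => _ _ _ _ [_ _ /ltW].
- move=> x /= nEB; apply: contrapT => /existsNP[n /not_implyP[_ nF]]; apply: nEB.
  (* From index n on, x avoids every U_k - K_k: it lies either in K_k, hence in both E and C_k, or
     outside U_k, hence in neither. *)
  have nFk k : (n <= k)%N -> (E x <-> C k x).
    move=> nk; case: (HU k) => _ _ KE EU [KC CU _].
    have [Ux|nUx] := pselect (U k x); last by split=> [/EU|/CU].
    have [Kx|nKx] := pselect (K k x); first by split=> _; [exact: KC|exact: KE].
    by exfalso; apply: nF; exists k.
  split=> [Ex m _|/(_ n I)[k /= nk Ckx]]; last by apply/(nFk k).
  exists (maxn m n); first by rewrite /= leq_maxl.
  by apply/nFk => //; exact: leq_maxr.
Qed.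

(* f' is the supremum of the q 1_(B_q), with B_q a Baire version of {f > q} and q
   running over the positive rationals. *)
Lemma ae_baire_ge0 (f : borel G -> R) :
  mu.-integrable setT (EFin \o f) -> (forall x, 0 <= f x)%R ->
  exists (f' : G -> R) (K : nat -> set G),
    [/\ measurable_fun setT (f' : baire G -> R), forall n, compact (K n),
      forall x, ~ (\bigcup_n K n) x -> f' x = 0%R & {ae mu, forall x, f x = f' x}].
Proof.
move=> intf f0; have mf := measurable_int mu intf.
(* Codes that decode to no positive rational receive the default value 1. All thresholds are then
   positive, so every set {f > q n} has finite measure. *)
pose q n : R := let r : R := ratr (odflt 0%Q (unpickle n)) in (if 0 < r then r else 1)%R.
have q0 n : (0 < q n)%R by rewrite /q; case: ifPn.
have qin (a b : R) : (0 <= a)%R -> (a < b)%R -> exists n, (a < q n < b)%R.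
  move=> a0 /rat_in_itvoo[r]; rewrite in_itv/= => /andP[ar rb].
  by exists (pickle r); rewrite /q pickleK /= (le_lt_trans a0 ar) ar rb.
pose E n : set (borel G) := [set x | (q n)%:E < (f x)%:E].
have mE n : measurable (E n).
  rewrite -[E n]setTI; exact: emeasurable_fun_o_infty.
have Eoo n : mu (E n) < +oo.
  have [ml loo] := integrable_level_lty intf (q0 n).
  apply: le_lt_trans loo; apply: le_measure; rewrite ?inE//.
  by move=> x; rewrite /E /= lte_fin => /ltW; rewrite ger0_norm.
have /choice[B HB] n := ae_baire_set (mE n) (Eoo n).
have /choice[K HK] := HB.
have mB n : measurable (B n : set (baire G)) by case: (HK n).
pose h n x : \bar R := (q n * \1_(B n) x)%:E.
pose L x := ereal_sup [set h n x | n in setT].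
have h0 n x : 0 <= h n x by rewrite lee_fin mulr_ge0// ltW.
have L0 x : 0 <= L x.
  by apply: le_trans (h0 0%N x) _; apply: ereal_sup_ubound; exists 0%N.
exists (fun x => fine (L x)),
  (fun p => if unpickle p is Some (n, m) then K n m else set0).
split.
- apply: (@measurableT_comp _ _ _ _ _ _ fine) => //.
  have -> : L = (fun x => esups (h ^~ x) 0%N).
    apply/funext => x; rewrite /esups /L; congr ereal_sup.
    by apply/seteqP; split=> _ [n _ <-]; exists n.
  apply: measurable_fun_esups => n; apply/measurable_EFinP.
  apply: measurable_funM => //; exact: measurable_indic.
- move=> p; case: unpickle => [[n m]|]; last exact: compact0.
  by case: (HK n).
- move=> x nK; rewrite (_ : L x = 0)//.
  apply/eqP; rewrite eq_le L0 andbT; apply: ge_ereal_sup => _ [n _ <-].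
  rewrite /h indicE memNset ?mulr0// => Bnx; apply: nK.
  case: (HK n) => _ _ BK _; have [m _ Kx] := BK x Bnx.
  by exists (pickle (n, m)); rewrite ?pickleK.
have : {ae mu, forall x, forall n, E n x <-> B n x}.
  by apply/ae_foralln => n; case: (HK n).
apply: filterS => x /= EB; rewrite (_ : L x = (f x)%:E)//.
have hE n : h n x = if (q n < f x)%R then (q n)%:E else 0.
  rewrite /h indicE; case: ifPn => qf.
    by rewrite mem_set ?mulr1//; apply/EB; rewrite /E /= lte_fin.
  by rewrite memNset ?mulr0// => /EB; rewrite /E /= lte_fin; apply/negP.
apply/eqP; rewrite eq_le; apply/andP; split.
  apply: ge_ereal_sup => _ [n _ <-]; rewrite hE; case: ifPn => [/ltW|_].
    by rewrite lee_fin.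
  by rewrite lee_fin.
(* A threshold strictly between L x and f x would itself be one of the terms of the supremum L x. *)
rewrite leNgt; apply/negP => Lf.
have Lfin : L x \is a fin_num by rewrite ge0_fin_numE// (lt_trans Lf)// ltry.
move: (Lf); rewrite -(fineK Lfin) lte_fin => /(qin _ _ (fine_ge0 (L0 x)))[n /andP[Lq qf]].
have : h n x <= L x by apply: ereal_sup_ubound; exists n.
by rewrite hE qf -(fineK Lfin) lee_fin leNgt Lq.
Qed.

Lemma ae_baire_fun (f : borel G -> R) : mu.-integrable setT (EFin \o f) ->
  exists (f' : G -> R) (K : nat -> set G),
    [/\ measurable_fun setT (f' : baire G -> R), forall n, compact (K n),
      forall x, ~ (\bigcup_n K n) x -> f' x = 0%R & {ae mu, forall x, f x = f' x}].
Proof.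
move=> intf.
have [f1 [K1 [m1 c1 z1 e1]]] := ae_baire_ge0 (integrable_funrpos measurableT intf)
  (funrpos_ge0 f).
have [f2 [K2 [m2 c2 z2 e2]]] := ae_baire_ge0 (integrable_funrneg measurableT intf)
  (funrneg_ge0 f).
exists (fun x => f1 x - f2 x)%R, (fun n => K1 n `|` K2 n); split.
- exact: measurable_funB.
- by move=> n; exact: compactU.
- move=> x nK; rewrite z1 ?z2 ?subr0// => -[n _ Kx]; apply: nK; exists n => //.
    by right.
  by left.
apply: filterS2 e1 e2 => x <- <-.
by rewrite -[in LHS](funrposBneg f).
Qed.

Lemma ae_baire_cfun (f : borel G -> R[i]) : cintegrable mu f ->
  exists (f' : G -> R[i]) (K : nat -> set G),
    [/\ cmeasurable (f' : baire G -> R[i]), forall n, compact (K n),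
      forall x, ~ (\bigcup_n K n) x -> f' x = 0%R & {ae mu, forall x, f x = f' x}].
Proof.
move=> [/ae_baire_fun[f1 [K1 [m1 c1 z1 e1]]] /ae_baire_fun[f2 [K2 [m2 c2 z2 e2]]]].
exists (fun x => f1 x +i* f2 x)%C, (fun n => K1 n `|` K2 n); split.
- by split.
- by move=> n; exact: compactU.
- move=> x nK; rewrite z1 ?z2// => -[n _ Kx]; apply: nK; exists n => //.
    by right.
  by left.
by apply: filterS2 e1 e2 => x /=; case: (f x) => a b /= -> ->.
Qed.

End BaireApproximation.

(** * Fubini's theorem for Haar measure *)

Section MeasurePreserving.
Context d (T : measurableType d) {R : realType} (mu : {measure set T -> \bar R}).
Variables (h : T -> T) (mh : measurable_fun setT h).
Hypothesis hE : forall A, measurable A -> mu (h @^-1` A) = mu A.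
Local Open Scope ereal_scope.

Lemma ge0_integral_preserving (F : T -> \bar R) : measurable_fun setT F ->
  (forall x, 0 <= F x) -> \int[mu]_x F (h x) = \int[mu]_x F x.
Proof.
move=> mF F0; transitivity (\int[pushforward mu h]_x F x).
  by rewrite (ge0_integral_pushforward mh mu measurableT).
by apply: eq_measure_integral => A mA _; exact: hE.
Qed.

Lemma integral_preserving (F : T -> \bar R) : measurable_fun setT F ->
  \int[mu]_x F (h x) = \int[mu]_x F x.
Proof.
move=> mF; rewrite integralE [RHS]integralE; congr (_ - _).
  rewrite -(ge0_integral_preserving (measurable_funepos mF) (funepos_ge0 F)).
  by apply: eq_integral => x _; rewrite -[F^\+ (h x)]/((F^\+ \o h) x) -funepos_comp.
rewrite -(ge0_integral_preserving (measurable_funeneg mF) (funeneg_ge0 F)).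
by apply: eq_integral => x _; rewrite -[F^\- (h x)]/((F^\- \o h) x) -funeneg_comp.
Qed.

Lemma cintegral_preserving (f : T -> R[i]) : cmeasurable f ->
  cintegral mu (fun x => f (h x)) = cintegral mu f.
Proof.
move=> [rf jf]; rewrite /cintegral /Rintegral; congr (fine _ +i* fine _)%C.
  by apply: (@integral_preserving (fun x => (complex.Re (f x))%:E)); exact/measurable_EFinP.
by apply: (@integral_preserving (fun x => (complex.Im (f x))%:E)); exact/measurable_EFinP.
Qed.

Lemma cintegrable_preserving (f : T -> R[i]) : cintegrable mu f ->
  cintegrable mu (fun x => f (h x)).
Proof.
move=> /cintegrableP[mf foo]; apply/cintegrableP; split.
  exact: (cmeasurable_comp mf mh).
rewrite (ge0_integral_preserving (measurable_cabs mf))// => x.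
by rewrite lee_fin cabs_ge0.
Qed.

Lemma ae_preserving (P : T -> Prop) :
  {ae mu, forall x, P x} -> {ae mu, forall x, P (h x)}.
Proof.
move=> [N [mN N0 PN]]; exists (h @^-1` N); split.
- by rewrite -[X in measurable X]setTI; exact: mh.
- by rewrite hE.
- by move=> x; exact: PN.
Qed.

End MeasurePreserving.

Section SigmaCompact.
Context {R : realType} {G : topologicalZmodType} (mu : haar_measure R G).
Hypothesis hausG : hausdorff_space G.

Definition sigma_compact (H : set G) :=
  exists2 K : nat -> set G, forall n, compact (K n) & H = \bigcup_n K n.

Lemma sigma_compact_measurable (H : set G) :
  sigma_compact H -> measurable (H : set (borel G)).
Proof.
move=> [K cK ->]; apply: bigcup_measurable => n _.
exact: (compact_measurable hausG (cK n)).
Qed.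

Lemma sigma_compact_baire_measurable (H : set G) (phi : G * G -> G) :
  sigma_compact H -> continuous phi ->
  @measurable_fun _ _ (borel G * borel G)%type (baire G) (H `*` H) phi.
Proof. by move=> [K cK ->] cphi; exact: continuous_baire_measurable. Qed.

(* Haar measure itself need not be sigma-finite. *)
Lemma haar_restriction (H : set (borel G)) : sigma_compact H ->
  exists nu : {sigma_finite_measure set (borel G) -> \bar R},
    forall A, measurable A -> nu A = mu (A `&` H).
Proof.
move=> sH; have mH := sigma_compact_measurable sH; have [K cK KH] := sH.
pose nu := mrestr mu mH.
have sf : sigma_finite setT nu.
  (* The complement of [H] is null for the restriction, so adding it to every [K n] exhausts the
     group and keeps the measures finite. *)
  exists (fun n => K n `|` ~` H).
    apply/seteqP; split=> // x _; have [Hx|nHx] := pselect (H x).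
      by move: Hx; rewrite KH => -[n _ Kx]; exists n => //; left.
    by exists 0%N => //; right.
  move=> n; have mK := compact_measurable hausG (cK n).
  split; first by apply: measurableU => //; exact: measurableC.
  rewrite /nu /mrestr setIUl setICl setU0.
  apply: le_lt_trans (haar_compact mu (cK n)).
  apply: le_measure; rewrite ?inE//; first exact: measurableI.
pose nu' : {sigma_finite_measure set (borel G) -> \bar R} :=
  HB.pack nu (@Measure_isSigmaFinite.Build _ _ _ nu sf).
by exists nu'.
Qed.

Local Open Scope ereal_scope.

Lemma integral_restriction d (T : measurableType d) (m n : {measure set T -> \bar R})
    (H : set T) (f : T -> \bar R) :
  (forall A, measurable A -> n A = m (A `&` H)) ->
  (forall x, ~ H x -> f x = 0) -> \int[n]_x f x = \int[m]_x f x.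
Proof.
move=> nE f0; have fH : f \_ H = f.
  by apply/funext => x; rewrite patchE; case: ifPn => // /negP; rewrite inE => /f0.
transitivity (\int[n]_(x in H) f x); first by rewrite [RHS]integral_mkcond fH.
transitivity (\int[m]_(x in H) f x); last by rewrite [LHS]integral_mkcond fH.
by apply: eq_measure_integral => A mA AH; rewrite nE// setIidl.
Qed.

Lemma haar_Tonelli (H : set (borel G)) (f : borel G * borel G -> \bar R) :
  sigma_compact H -> measurable_fun setT f -> (forall z, 0 <= f z) ->
  (forall x y, ~ (H x /\ H y) -> f (x, y) = 0) ->
  \int[mu]_x \int[mu]_y f (x, y) = \int[mu]_y \int[mu]_x f (x, y).
Proof.
move=> /haar_restriction[nu nuE] mf f0 fH.
have e1 x : \int[mu]_y f (x, y) = \int[nu]_y f (x, y).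
  by rewrite (integral_restriction nuE)// => y nHy; apply: fH => -[].
have e2 y : \int[mu]_x f (x, y) = \int[nu]_x f (x, y).
  by rewrite (integral_restriction nuE)// => x nHx; apply: fH => -[].
under eq_integral do rewrite e1; under [RHS]eq_integral do rewrite e2.
rewrite -(integral_restriction nuE) => [|x nHx]; last first.
  by under eq_integral do rewrite (fH _ _ (fun h => nHx h.1)); rewrite integral0.
rewrite -[RHS](integral_restriction nuE) => [|x nHx]; last first.
  by under eq_integral do rewrite (fH _ _ (fun h => nHx h.2)); rewrite integral0.
exact: fubini_tonelli.
Qed.

Lemma haar_Tonelli_measurable (H : set (borel G)) (f : borel G * borel G -> \bar R) :
  sigma_compact H -> measurable_fun setT f -> (forall z, 0 <= f z) ->
  (forall x y, ~ (H x /\ H y) -> f (x, y) = 0) ->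
  measurable_fun setT (fun x => \int[mu]_y f (x, y)).
Proof.
move=> /haar_restriction[nu nuE] mf f0 fH.
have := measurable_fun_fubini_tonelli_F (m2 := nu) f mf f0.
rewrite (_ : fubini_F nu f = (fun x => \int[mu]_y f (x, y)))//.
apply/funext => x; apply: (integral_restriction nuE) => y nHy.
by apply: fH => -[].
Qed.

Lemma cintegral_restriction (m n : {measure set (borel G) -> \bar R})
    (H : set (borel G)) (f : borel G -> R[i]) :
  (forall A, measurable A -> n A = m (A `&` H)) ->
  (forall x, ~ H x -> f x = 0%R) -> cintegral n f = cintegral m f.
Proof.
move=> nE f0; rewrite /cintegral /Rintegral; congr (fine _ +i* fine _)%C.
  by apply: (integral_restriction nE) => x /f0 ->.
by apply: (integral_restriction nE) => x /f0 ->.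
Qed.

Lemma cintegrable_restriction (m n : {measure set (borel G) -> \bar R})
    (H : set (borel G)) (f : borel G -> R[i]) :
  (forall A, measurable A -> n A = m (A `&` H)) ->
  (forall x, ~ H x -> f x = 0%R) -> cintegrable n f -> cintegrable m f.
Proof.
move=> nE f0 /cintegrableP[mf foo]; apply/cintegrableP; split=> //.
by rewrite -(integral_restriction nE)// => x /f0 ->; rewrite cabs0.
Qed.

Lemma haar_Fubini (H : set (borel G)) (k : borel G * borel G -> R[i]) :
  sigma_compact H -> cmeasurable k ->
  (forall x y, ~ (H x /\ H y) -> k (x, y) = 0%R) ->
  \int[mu]_x \int[mu]_y (cabs (k (x, y)))%:E < +oo ->
  [/\ {ae mu, forall x, cintegrable mu (fun y => k (x, y))},
      cintegrable mu (fun x => cintegral mu (fun y => k (x, y))) &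
      cintegral mu (fun x => cintegral mu (fun y => k (x, y))) =
      cintegral mu (fun y => cintegral mu (fun x => k (x, y)))].
Proof.
move=> sH mk kH koo; have [nu nuE] := haar_restriction sH.
have mH := sigma_compact_measurable sH.
have k1 x y : ~ H x -> k (x, y) = 0%R by move=> nHx; apply: kH => -[].
have k2 x y : ~ H y -> k (x, y) = 0%R by move=> nHx; apply: kH => -[].
have koo' : \int[nu]_x \int[nu]_y (cabs (k (x, y)))%:E < +oo.
  rewrite (integral_restriction nuE) => [|x nHx]; last first.
    by under eq_integral do rewrite (k1 _ _ nHx) cabs0; rewrite integral0.
  rewrite (eq_integral (fun x => \int[mu]_y (cabs (k (x, y)))%:E))// => x _.
  by rewrite (integral_restriction nuE)// => y nHy; rewrite k2// cabs0.
have [a i e] := Fubini_cintegral mk koo'.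
have c0 (m : {measure set (borel G) -> \bar R}) : cintegral m (fun=> 0%R) = 0%R.
  by rewrite /cintegral /Rintegral /= integral0.
have e1 x : cintegral nu (fun y => k (x, y)) = cintegral mu (fun y => k (x, y)).
  by apply: (cintegral_restriction nuE) => y; exact: k2.
have e2 y : cintegral nu (fun x => k (x, y)) = cintegral mu (fun x => k (x, y)).
  by apply: (cintegral_restriction nuE) => x; exact: k1.
have z1 x : ~ H x -> cintegral mu (fun y => k (x, y)) = 0%R.
  move=> nHx; rewrite (_ : (fun y => k (x, y)) = (fun=> 0%R)) ?c0//.
  by apply/funext => y; exact: k1.
have z2 y : ~ H y -> cintegral mu (fun x => k (x, y)) = 0%R.
  move=> nHy; rewrite (_ : (fun x => k (x, y)) = (fun=> 0%R)) ?c0//.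
  by apply/funext => x; exact: k2.
split.
(* The restriction controls only the trace of the exceptional set on [H]; outside [H] the slice
   vanishes identically and is integrable. *)
- case: a => N [mN N0 HN]; exists (N `&` H); split; [exact: measurableI|by rewrite -nuE|].
  move=> x nix; have [Hx|nHx] := pselect (H x); last first.
    exfalso; apply: nix => /=; rewrite (_ : (fun y => k (x, y)) = (fun=> 0%R)).
      by split; exact: integrable0.
    by apply/funext => y; exact: k1.
  split=> //; apply: HN => /= ix; apply: nix.
  by apply: (cintegrable_restriction nuE _ ix) => y; exact: k2.
- by apply: (cintegrable_restriction nuE z1); rewrite -(funext e1).
- move: e; rewrite (funext e1) (funext e2).
  by rewrite !(cintegral_restriction nuE).
Qed.

(** [haar_Fubini] describes the slices in one variable only. Tonelli makes the finiteness condition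
    symmetric, so it also applies to the transposed kernel. *)
Lemma haar_Fubini_swap (H : set (borel G)) (k : borel G * borel G -> R[i]) :
  sigma_compact H -> cmeasurable k ->
  (forall x y, ~ (H x /\ H y) -> k (x, y) = 0%R) ->
  \int[mu]_x \int[mu]_y (cabs (k (x, y)))%:E < +oo ->
  {ae mu, forall y, cintegrable mu (fun x => k (x, y))} /\
  cintegrable mu (fun y => cintegral mu (fun x => k (x, y))).
Proof.
move=> sH mk kH koo.
pose k' (z : borel G * borel G) := k (z.2, z.1).
have mk' : cmeasurable k' := cmeasurable_comp mk (@measurable_swap _ _ _ _).
have kH' x y : ~ (H x /\ H y) -> k' (x, y) = 0%R.
  by move=> nH; apply: kH => -[Hy Hx]; exact: nH.
have koo' : \int[mu]_x \int[mu]_y (cabs (k' (x, y)))%:E < +oo.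
  rewrite (haar_Tonelli sH (f := fun z => (cabs (k' z))%:E))//.
  - exact: measurable_cabs.
  - by move=> z; rewrite lee_fin cabs_ge0.
  - by move=> x y /kH' ->; rewrite cabs0.
by have [] := haar_Fubini sH mk' kH' koo'.
Qed.

End SigmaCompact.

(** * Invariance of Haar measure under inversion *)

Section Inversion.
Context {R : realType} {G : topologicalZmodType} (mu : haar_measure R G).
Hypothesis hausG : hausdorff_space G.
Hypothesis lcG : locally_compact [set: G].
Implicit Types (A : set (borel G)) (C D K U : set G).
Local Open Scope ereal_scope.

Lemma addr_borel (a : G) : measurable_fun setT (fun y : borel G => y + a : borel G)%R.
Proof. by apply: continuous_borel; exact: addr_continuous. Qed.

Lemma oppr_borel : measurable_fun setT (fun y : borel G => - y : borel G)%R.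
Proof. by apply: continuous_borel; exact: opp_continuous. Qed.

Lemma haar_addr (a : G) A : measurable A ->
  mu ((fun y => y + a)%R @^-1` A) = mu A.
Proof.
move=> mA; rewrite -(haar_invariant mu (- a)%R mA) translate_preimage.
by congr (mu _); apply/funext => y /=; rewrite opprK.
Qed.

(* Both sides are the integral of 1_C(x - y) 1_D(y) over G * G: integrating in x
   first gives mu(C) mu(D), while the substitution y = x + t gives mu(- C) mu(D). *)
Lemma haar_oppr_gdelta C D : compact_gdelta C -> compact_gdelta D ->
  mu C * mu D = mu ((fun y => - y)%R @^-1` C) * mu D.
Proof.
move=> gC gD; have cC := gC.1; have cD := gD.1.
have mC := compact_measurable hausG cC; have mD := compact_measurable hausG cD.
have [K [cK AK K0 KB]] := @sigma_compact_subgroup G (fun=> C `|` D)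
  (fun=> compactU cC cD).
set H := \bigcup_n K n in AK K0 KB.
have sH : sigma_compact H by exists K.
have mH := sigma_compact_measurable hausG sH.
have CH x : C x -> H x by move=> Cx; apply: (AK 0%N); left.
have DH x : D x -> H x by move=> Dx; apply: (AK 0%N); right.
have KN x : H x -> H (- x)%R by move=> Hx; rewrite -sub0r; exact: KB.
have KD x y : H x -> H y -> H (x + y)%R.
  by move=> Hx Hy; rewrite -(opprK y); apply: KB => //; exact: KN.
have mB E : compact_gdelta E -> measurable (E : set (baire G)).
  exact: sub_sigma_algebra.
have mHH : measurable (H `*` H : set (borel G * borel G)) by exact: measurableX.
pose S1 : set (borel G * borel G) :=
  ((H `*` H) `&` (fun z => z.1 - z.2)%R @^-1` C) `&` (setT `*` D).
pose S2 : set (borel G * borel G) :=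
  ((H `*` H) `&` (fun z => z.1 + z.2)%R @^-1` D) `&` (setT `*` ((fun y => - y)%R @^-1` C)).
have mNC : measurable ((fun y => - y)%R @^-1` C : set (borel G)).
  by rewrite -[X in measurable X]setTI; exact: oppr_borel.
have mS1 : measurable S1.
  apply: measurableI; last by apply: measurableX.
  exact: (sigma_compact_baire_measurable hausG sH (@sub_continuous G) mHH (mB _ gC)).
have mS2 : measurable S2.
  apply: measurableI; last by apply: measurableX.
  exact: (sigma_compact_baire_measurable hausG sH (@add_continuous G) mHH (mB _ gD)).
have mI d (T : measurableType d) (E : set T) : measurable E ->
    measurable_fun setT (fun x => (\1_E x : R)%:E).
  by move=> mE; apply/measurable_EFinP; exact: measurable_indic.
have pI (T : Type) (E : set T) x : 0 <= (\1_E x : R)%:E by rewrite lee_fin indicE.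
have tonelli (S : set (borel G * borel G)) : measurable S -> S `<=` H `*` H ->
    \int[mu]_x \int[mu]_y (\1_S (x, y) : R)%:E = \int[mu]_y \int[mu]_x (\1_S (x, y) : R)%:E.
  move=> mS SH; have := @haar_Tonelli R G mu hausG H (fun z => (\1_S z)%:E) sH; apply.
  - exact: mI.
  - by move=> z; exact: pI.
  - by move=> x y nH; rewrite indicE memNset// => /SH.
(* Cavalieri's principle in a form that serves both [S1] and [S2]: a section at a point of [F] is
   the preimage of [E] under a measure-preserving map, and all other sections are empty. *)
have slice (E F : set (borel G)) (h : G -> borel G -> borel G)
      (S : set (borel G * borel G)) :
    measurable E -> measurable F ->
    (forall y, measurable_fun setT (h y)) ->
    (forall y A, measurable A -> mu (h y @^-1` A) = mu A) ->
    (forall x y, S (x, y) <-> E (h y x) /\ F y) ->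
    \int[mu]_y \int[mu]_x (\1_S (x, y) : R)%:E = mu E * mu F.
  move=> mE mF mh hP SE.
  have muE : \int[mu]_x (\1_E x : R)%:E = mu E by rewrite integral_indic// setIT.
  under eq_integral => y _.
    rewrite (_ : integral _ _ _ = mu E * (\1_F y)%:E).
      over.
    have [Fy|nFy] := pselect (F y).
      rewrite indicE mem_set// mule1 -[RHS]muE.
      rewrite -(ge0_integral_preserving (mh y) (hP y) (mI _ _ _ mE) (pI _ _)).
      apply: eq_integral => x _; rewrite !indicE (_ : ((x, y) \in S) = (h y x \in E))//.
      by apply/idP/idP => /set_mem H1; apply: mem_set; [case/SE: H1|apply/SE].
    rewrite indicE memNset// mule0; under eq_integral => x _.
      rewrite indicE memNset; first over.
      by rewrite SE => -[].
    by rewrite integral0.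
  rewrite ge0_integralZl//; [|exact: mI].
  by rewrite integral_indic// setIT.
rewrite -(slice C D (fun y x => x - y)%R S1)//; first last.
- move=> x y; split=> [[[_ Cxy] [_ Dy]]|[Cxy Dy]]//; split; last by split.
  split=> //; split; last exact: DH.
  by rewrite /= -(subrK y x); apply: KD; [exact: CH|exact: DH].
- by move=> y A mA; exact: haar_addr.
- by move=> y; exact: addr_borel.
rewrite -tonelli//; last by move=> z [[]].
transitivity (\int[mu]_x \int[mu]_t (\1_S2 (x, t) : R)%:E).
  apply: eq_integral => x _.
  have m1 : measurable_fun setT (fun y => (\1_S1 (x, y) : R)%:E).
    exact: (@measurable_fun_pair2 _ _ _ _ _ _ (fun z => (\1_S1 z : R)%:E) x (mI _ _ _ mS1)).
  rewrite -[LHS](ge0_integral_preserving (addr_borel x) (haar_addr x) m1) => [|y]; last first.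
    exact: pI.
  apply: eq_integral => t _; rewrite !indicE.
  rewrite (_ : ((x, (t + x)%R) \in S1) = ((x, t) \in S2))//.
  have e : (x - (t + x) = - t)%R by rewrite opprD addrCA subrr addr0.
  apply/idP/idP => /set_mem -[[[/= Hx Ht]]]; rewrite ?e => H1 [_ H2]; apply: mem_set.
    do ![split => //=]; last by rewrite addrC.
    by rewrite -(addrK x t); exact: KB.
  do ![split => //=]; rewrite ?e//; last by rewrite addrC.
  exact: KD.
rewrite tonelli//; last by move=> z [[]].
rewrite (slice D ((fun y => - y)%R @^-1` C) (fun y x => x + y)%R S2)//; first by rewrite muleC.
- by move=> y; exact: addr_borel.
- by move=> y A mA; exact: haar_addr.
- move=> x y; split=> [[[_ Cxy] [_ Dy]]|[Cxy Dy]]//; split; last by split.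
  have Hy : H y by rewrite -(opprK y); apply: KN; exact: CH.
  split=> //; split => //.
  by rewrite /= -(addrK y x); apply: KB => //; exact: DH.
Qed.

(** This supplies the factor to cancel in [haar_oppr_gdelta]. If all compact G_delta sets were null,
    so would be every compact set, being contained in one, and inner regularity would make the whole
    group null. *)
Lemma haar_gdelta_gt0 : exists2 D, compact_gdelta D & 0 < mu D < +oo.
Proof.
have [D gD D0] : exists2 D, compact_gdelta D & 0 < mu D.
  apply: contrapT => nD; have := haar_neq0 mu; rewrite -measure_gt0; apply/negP.
  rewrite -leNgt [X in X <= _](haar_inner_regular mu (@openT G)); apply: ge_ereal_sup => _ [K [cK _] <-].
  rewrite leNgt; apply/negP => K0; apply: nD.
  have [C gC [KC _]] := compact_gdelta_between lcG cK openT (@subsetT _ _).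
  exists C => //; apply: (lt_le_trans K0); apply: le_measure => //; rewrite inE.
    exact: compact_measurable.
  exact: (compact_measurable hausG gC.1).
by exists D => //; rewrite D0 (haar_compact mu gD.1).
Qed.

Lemma oppr_imageK (B : set G) : -%R @` (-%R @` B) = B.
Proof. by rewrite !oppr_preimage; apply/funext => x /=; rewrite opprK. Qed.

(** A compact G_delta C between K and a slightly larger open U satisfies mu(- C) = mu(C). Regularity
    carries only inequalities from here to open and then to measurable sets, but inversion is an
    involution, so the last inequality applied to - A gives the reverse one. *)
Let haar_oppr_compact K : compact K -> mu (-%R @` K) <= mu K.
Proof.
move=> cK; have [D gD /andP[D0 Doo]] := haar_gdelta_gt0.
have mK := compact_measurable hausG cK.
apply/lee_addgt0Pr => e e0.
have [U oU [KU Uoo UK]] := haar_open_approx mK (haar_compact mu cK) e0.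
have mU := open_measurable_borel oU.
have [C gC [KC CU]] := compact_gdelta_between lcG cK oU KU.
have mC := compact_measurable hausG gC.1.
have Dfin : mu D \is a fin_num by rewrite ge0_fin_numE.
have CE : mu (-%R @` C) = mu C.
  have := haar_oppr_gdelta gC gD.
  rewrite -(@oppr_preimage G C) => e1.
  have h1 := lee_pmul2r Dfin D0 (mu (-%R @` C)) (mu C).
  have h2 := lee_pmul2r Dfin D0 (mu C) (mu (-%R @` C)).
  by apply/eqP; rewrite eq_le -h1 -h2 /= -e1 lexx.
have mNC : measurable (-%R @` C : set (borel G)).
  exact: (compact_measurable hausG (compact_oppr gC.1)).
have mNK : measurable (-%R @` K : set (borel G)).
  exact: (compact_measurable hausG (compact_oppr cK)).
apply: (@le_trans _ _ (mu (-%R @` C))).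
  by apply: le_measure; rewrite ?inE//; exact: image_subset.
rewrite CE; apply: (@le_trans _ _ (mu U)).
  by apply: le_measure; rewrite ?inE.
have -> : U = K `|` (U `\` K) by rewrite setDUK.
apply: le_trans (measureU2 mu mK (measurableD mU mK)) _.
by rewrite leeD2l// ltW.
Qed.

Let haar_oppr_open U : open U -> mu (-%R @` U) <= mu U.
Proof.
move=> oU; rewrite (haar_inner_regular mu (open_oppr oU)).
apply: ge_ereal_sup => _ [K [cK KU] <-].
rewrite -[K in mu K]oppr_imageK; apply: le_trans (haar_oppr_compact (compact_oppr cK)) _.
apply: le_measure; rewrite ?inE.
- exact: (compact_measurable hausG (compact_oppr cK)).
- exact: open_measurable_borel.
- by move=> _ [x /KU[u Uu <-] <-]; rewrite opprK.
Qed.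

Let haar_oppr_le A : measurable A -> mu (-%R @` A) <= mu A.
Proof.
move=> mA; rewrite (haar_outer_regular mu mA); apply: le_ereal_inf_tmp => _ [U [oU AU] <-].
apply: le_trans (haar_oppr_open oU); apply: le_measure; rewrite ?inE.
- by rewrite oppr_preimage -[X in measurable X]setTI; exact: oppr_borel.
- exact: (open_measurable_borel (open_oppr oU)).
- exact: image_subset.
Qed.

Lemma haar_oppr A : measurable A -> mu ((fun y => - y)%R @^-1` A) = mu A.
Proof.
move=> mA; rewrite -(@oppr_preimage G A); apply/eqP; rewrite eq_le haar_oppr_le//=.
have mNA : measurable (-%R @` A : set (borel G)).
  by rewrite oppr_preimage -[X in measurable X]setTI; exact: oppr_borel.
apply: le_trans (haar_oppr_le mNA).
by rewrite oppr_imageK.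
Qed.

Lemma subr_borel (x : G) : measurable_fun setT (fun y : borel G => x - y : borel G)%R.
Proof.
by have := measurableT_comp (addr_borel x) oppr_borel; apply: eq_measurable_fun => y _ /=; rewrite addrC.
Qed.

Lemma haar_subr (x : G) A : measurable A -> mu ((fun y => x - y)%R @^-1` A) = mu A.
Proof.
move=> mA; rewrite -(haar_addr x mA) -(haar_oppr (A := (fun y => y + x)%R @^-1` A)).
  by congr (mu _); apply/funext => y /=; rewrite addrC.
by rewrite -[X in measurable X]setTI; exact: addr_borel.
Qed.

End Inversion.

(** * Convolution *)

(** Fubini gives integrability of the product a f, not of f. For nonzero a it passes to f by
    division; for a = 0 both sides vanish, whatever the integral of f is. *)
Lemma cintegralZ_slice d (T : measurableType d) (R : realType)
    (mu : {measure set T -> \bar R}) (a : R[i]) (f : T -> R[i]) :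
  cintegrable mu (fun x => a * f x) ->
  cintegral mu (fun x => a * f x) = a * cintegral mu f.
Proof.
have [->|a0] := eqVneq a 0.
  move=> _; rewrite mul0r (_ : (fun x => _) = fun=> 0) => [|].
    by rewrite /cintegral /Rintegral /= integral0.
  by apply/funext => x; rewrite mul0r.
move=> iaf; rewrite -[in RHS](_ : (fun x => a^-1 * (a * f x)) = f); last first.
  by apply/funext => x; rewrite mulKf.
by rewrite (cintegralZ _ iaf) mulVKf.
Qed.

Lemma cintegrableZ d (T : measurableType d) (R : realType)
    (mu : {measure set T -> \bar R}) (a : R[i]) (f : T -> R[i]) :
  cintegrable mu f -> cintegrable mu (fun x => a * f x).
Proof.
move=> fi; have := (cintegrable_submod_closed mu).2 a f 0.
by rewrite !inE addr0; apply => //; split; exact: integrable0.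
Qed.

Lemma cintegrableD d (T : measurableType d) (R : realType)
    (mu : {measure set T -> \bar R}) (f g : T -> R[i]) :
  cintegrable mu f -> cintegrable mu g -> cintegrable mu (fun x => f x + g x).
Proof.
move=> fi gi; have := (cintegrable_submod_closed mu).2 1 f g.
by rewrite !inE scale1r; exact.
Qed.

Section Convolution.
Context {R : realType} {G : topologicalZmodType} (mu : haar_measure R G).
Hypothesis hausG : hausdorff_space G.
Hypothesis lcG : locally_compact [set: G].
Implicit Types (f g h : borel G -> R[i]) (H : set (borel G)).

Definition conv f g : borel G -> R[i] :=
  fun x => cintegral mu (fun y => f y * g (x - y)).

Definition sigma_compact_group H := [/\ sigma_compact H, H 0 &
  forall x y, H x -> H y -> H (x - y)].

Lemma sigma_compact_groupD H x y : sigma_compact_group H -> H x -> H y -> H (x + y).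
Proof.
by move=> [_ H0 HB] Hx Hy; rewrite -(opprK y); apply: (HB) => //; rewrite -sub0r; exact: HB.
Qed.

(** Associativity involves three functions at once; a common subgroup confines all their kernels to
    the same square H * H. *)
Lemma ae_baire3 f g h : cintegrable mu f -> cintegrable mu g -> cintegrable mu h ->
  exists H f' g' h', [/\ sigma_compact_group H,
    [/\ cmeasurable (f' : baire G -> R[i]), forall x, ~ H x -> f' x = 0 &
        {ae mu, forall x, f x = f' x}],
    [/\ cmeasurable (g' : baire G -> R[i]), forall x, ~ H x -> g' x = 0 &
        {ae mu, forall x, g x = g' x}] &
    [/\ cmeasurable (h' : baire G -> R[i]), forall x, ~ H x -> h' x = 0 &
        {ae mu, forall x, h x = h' x}]].
Proof.
move=> /(ae_baire_cfun hausG lcG)[f' [K1 [mf c1 f0 ff]]].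
move=> /(ae_baire_cfun hausG lcG)[g' [K2 [mg c2 g0 gg]]].
move=> /(ae_baire_cfun hausG lcG)[h' [K3 [mh c3 h0 hh]]].
have [K [cK AK K0 KB]] := @sigma_compact_subgroup G (fun n => K1 n `|` (K2 n `|` K3 n))
  (fun n => compactU (c1 n) (compactU (c2 n) (c3 n))).
exists (\bigcup_n K n), f', g', h'; split.
- by split => //; exists K.
- by split=> // x nx; apply: f0 => -[n _ Kx]; apply: nx; apply: (AK n); left.
- by split=> // x nx; apply: g0 => -[n _ Kx]; apply: nx; apply: (AK n); right; left.
- by split=> // x nx; apply: h0 => -[n _ Kx]; apply: nx; apply: (AK n); right; right.
Qed.

Lemma cmeasurable_baire_borel (f : G -> R[i]) :
  cmeasurable (f : baire G -> R[i]) -> cmeasurable (f : borel G -> R[i]).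
Proof. by move=> [rf jf]; split; exact: baire_measurable_fun. Qed.

Lemma cmeasurable_subr f (x : G) :
  cmeasurable f -> cmeasurable (fun y : borel G => f (x - y)).
Proof. by move=> mf; exact: (cmeasurable_comp mf (subr_borel x)). Qed.

Lemma cmeasurable_conv_slice f g (x : G) : cmeasurable f -> cmeasurable g ->
  cmeasurable (fun y : borel G => f y * g (x - y)).
Proof. by move=> mf mg; apply: cmeasurableM => //; exact: cmeasurable_subr. Qed.

Lemma conv_slice_ae f f' g g' (x : G) : {ae mu, forall y, f y = f' y} ->
  {ae mu, forall y, g y = g' y} ->
  {ae mu, forall y, f y * g (x - y) = f' y * g' (x - y)}.
Proof.
move=> ff /(ae_preserving (subr_borel x) (haar_subr mu hausG lcG x)).
by apply: filterS2 ff => y -> ->.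
Qed.

(** Equality holds at every x, because y -> x - y preserves Haar measure and hence pulls null sets
    back to null sets. A convolution may thus be nested inside another one after its factors are
    replaced. *)
Lemma eq_conv f f' g g' : cmeasurable f -> cmeasurable f' -> cmeasurable g ->
  cmeasurable g' -> {ae mu, forall y, f y = f' y} ->
  {ae mu, forall y, g y = g' y} -> conv f g =1 conv f' g'.
Proof.
move=> mf mf' mg mg' ff gg x; apply: ae_eq_cintegral.
- exact: cmeasurable_conv_slice.
- exact: cmeasurable_conv_slice.
- exact: conv_slice_ae.
Qed.

Lemma convC f g : cmeasurable f -> cmeasurable g -> conv f g =1 conv g f.
Proof.
move=> mf mg x; rewrite /conv.
rewrite -(cintegral_preserving (subr_borel x) (haar_subr mu hausG lcG x)); last first.
  exact: cmeasurable_conv_slice.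
by congr cintegral; apply/funext => y; rewrite subKr mulrC.
Qed.

Lemma conv_oppr f g : cmeasurable f -> cmeasurable g ->
  forall x, conv f g (- x) = conv (fun y => f (- y)) (fun y => g (- y)) x.
Proof.
move=> mf mg x; rewrite /conv.
rewrite -(cintegral_preserving (@oppr_borel G) (haar_oppr mu hausG lcG)); last first.
  exact: cmeasurable_conv_slice.
by congr cintegral; apply/funext => y; rewrite opprB opprK addrC.
Qed.

(** Subtraction is measurable into the Baire sigma-algebra only on H * H, so g(x - y) is cut off
    there. For y in H nothing is lost: if x is outside H, so is x - y, and g vanishes. *)
Lemma conv_factor_measurable H g : sigma_compact_group H ->
  cmeasurable (g : baire G -> R[i]) -> (forall x, ~ H x -> g x = 0) ->
  exists g' : borel G * borel G -> R[i], cmeasurable g' /\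
    forall x y, H y -> g' (x, y) = g (x - y).
Proof.
move=> sH [rg jg] g0; have [sc H0 HB] := sH.
have mH := sigma_compact_measurable hausG sc.
have mHH : measurable (H `*` H : set (borel G * borel G)) by exact: measurableX.
have msub := sigma_compact_baire_measurable hausG sc (@sub_continuous G).
have meas (r : G -> R) : measurable_fun setT (r : baire G -> R) ->
    @measurable_fun _ _ (borel G * borel G)%type R setT
      ((fun z => r (z.1 - z.2)) \_ (H `*` H)).
  move=> mr; apply/(measurable_restrictT _ mHH).
  exact: (measurableT_comp mr msub).
exists (fun z => ((fun z => complex.Re (g (z.1 - z.2))) \_ (H `*` H)) z +i*
  ((fun z => complex.Im (g (z.1 - z.2))) \_ (H `*` H)) z)%C.
split; first by split; [exact: (meas _ rg)|exact: (meas _ jg)].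
move=> x y Hy; rewrite !patchE; case: ifPn => [_|].
  by case: (g (x - y)).
rewrite notin_setE => nHx; rewrite g0// => Hxy; apply: nHx; split => //=.
by rewrite -(subrK y x); exact: sigma_compact_groupD.
Qed.

(* Only the factor carrying the difference x - y has to be Baire. *)
Lemma conv_kernel_measurable H f g : sigma_compact_group H ->
  cmeasurable f -> (forall x, ~ H x -> f x = 0) ->
  cmeasurable (g : baire G -> R[i]) -> (forall x, ~ H x -> g x = 0) ->
  @cmeasurable _ (borel G * borel G)%type R (fun z => f z.2 * g (z.1 - z.2)).
Proof.
move=> sH mf f0 mg g0; have [g' [mg' gg']] := conv_factor_measurable sH mg g0.
rewrite (_ : (fun z => _) = (fun z : borel G * borel G => f z.2 * g' z)).
  by apply: cmeasurableM => //; exact: (cmeasurable_comp mf measurable_snd).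
apply/funext => -[x y] /=; have [Hy|nHy] := pselect (H y); first by rewrite gg'.
by rewrite f0// !mul0r.
Qed.

Local Open Scope ereal_scope.

(** [F] is allowed to be merely Borel and extended-valued because associativity uses it with the
    function y -> integral of [cabs (f z * g (y - z))] in z. The formula itself comes from
    integrating in x first and translating by y. *)
Lemma Tonelli_conv H (F : borel G -> \bar R) g : sigma_compact_group H ->
  measurable_fun setT F -> (forall x, 0 <= F x) -> (forall x, ~ H x -> F x = 0) ->
  cmeasurable (g : baire G -> R[i]) -> (forall x, ~ H x -> g x = 0%R) ->
  measurable_fun setT (fun x : borel G => \int[mu]_y (F y * (cabs (g (x - y)%R))%:E)) /\
  \int[mu]_x \int[mu]_y (F y * (cabs (g (x - y)%R))%:E) =
    \int[mu]_x F x * \int[mu]_x (cabs (g x))%:E.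
Proof.
move=> sH mF F0 FH mg g0; have [g' [mg' gg']] := conv_factor_measurable sH mg g0.
have [sc H0 HB] := sH; have mgB := cmeasurable_baire_borel mg.
pose k (z : borel G * borel G) := F z.2 * (cabs (g (z.1 - z.2)%R))%:E.
have mk : measurable_fun setT k.
  rewrite (_ : k = (fun z => F z.2 * (cabs (g' z))%:E)).
    by apply: emeasurable_funM; [exact: (measurableT_comp mF measurable_snd)|exact: measurable_cabs].
  apply/funext => -[x y]; rewrite /k /=; have [Hy|nHy] := pselect (H y).
    by rewrite gg'.
  by rewrite FH// !mul0e.
have k0 z : 0 <= k z by rewrite mule_ge0// lee_fin cabs_ge0.
have kH x y : ~ (H x /\ H y) -> k (x, y) = 0.
  move=> nH; rewrite /k /=; have [Hy|nHy] := pselect (H y); last by rewrite FH// mul0e.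
  rewrite g0 ?cabs0 ?mule0// => Hxy; apply: nH; split=> //.
  by rewrite -(subrK y x); exact: sigma_compact_groupD.
split.
  exact: (haar_Tonelli_measurable mu hausG sc mk k0 kH).
rewrite (haar_Tonelli mu hausG sc mk k0 kH).
have ge y (x : borel G) : 0 <= (cabs (g (x + y)%R))%:E by rewrite lee_fin cabs_ge0.
have e y : \int[mu]_x k (x, y) = F y * \int[mu]_x (cabs (g x))%:E.
  rewrite /k /= ge0_integralZl//; last first.
    exact: (measurable_cabs (cmeasurable_comp mgB (addr_borel (- y)%R))).
  congr (_ * _).
  apply: (ge0_integral_preserving (addr_borel (- y)%R) (haar_addr mu (- y)%R) (measurable_cabs mgB)).
  by move=> x; rewrite lee_fin cabs_ge0.
rewrite (eq_integral (fun y => F y * \int[mu]_x (cabs (g x))%:E)) => [|y _]; last exact: e.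
by rewrite ge0_integralZr//; apply: integral_ge0 => x _; rewrite lee_fin cabs_ge0.
Qed.

End Convolution.

(** * Convolution of Baire functions carried by a sigma-compact subgroup *)

Section ConvolutionAlgebra.
Context {R : realType} {G : topologicalZmodType} (mu : haar_measure R G).
Hypothesis hausG : hausdorff_space G.
Hypothesis lcG : locally_compact [set: G].
Implicit Types (f g h : borel G -> R[i]) (H : set (borel G)).
Local Notation conv := (conv mu).
Local Open Scope ereal_scope.

Definition baire_on H f :=
  [/\ cmeasurable (f : baire G -> R[i]), forall x, ~ H x -> f x = 0%R &
      cintegrable mu f].

Lemma conv_kernel_support H f g : sigma_compact_group H ->
  (forall x, ~ H x -> f x = 0%R) -> (forall x, ~ H x -> g x = 0%R) ->
  forall x y, ~ (H x /\ H y) -> (f y * g (x - y))%R = 0%R.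
Proof.
move=> sH f0 g0 x y nH; have [Hy|nHy] := pselect (H y); last by rewrite f0// mul0r.
rewrite g0 ?mulr0// => Hxy; apply: nH; split=> //.
by rewrite -(subrK y x); exact: sigma_compact_groupD.
Qed.

Lemma conv_kernel_lty H f g : sigma_compact_group H -> baire_on H f -> baire_on H g ->
  \int[mu]_x \int[mu]_y (cabs (f y * g (x - y))%R)%:E < +oo.
Proof.
move=> sH [mf f0 fi] [mg g0 gi]; have [sc _ _] := sH.
have mfB := cmeasurable_baire_borel hausG mf.
have mgB := cmeasurable_baire_borel hausG mg.
have mk := conv_kernel_measurable hausG sH mfB f0 mg g0.
have /cintegrableP[_ foo] := fi; have /cintegrableP[_ goo] := gi.
have F0 x : 0 <= (cabs (f x))%:E by rewrite lee_fin cabs_ge0.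
have FH x : ~ H x -> (cabs (f x))%:E = 0 by move=> /f0 ->; rewrite cabs0.
have [mC eC] := Tonelli_conv mu hausG sH (measurable_cabs mfB) F0 FH mg g0.
apply: (@le_lt_trans _ _
  (\int[mu]_x \int[mu]_y ((cabs (f y))%:E * (cabs (g (x - y)%R))%:E))).
  apply: ge0_le_integral => //.
  - by move=> x _; apply: integral_ge0 => y _; rewrite lee_fin cabs_ge0.
  - apply: (haar_Tonelli_measurable mu hausG sc (f := fun z => (cabs (f z.2 * g (z.1 - z.2))%R)%:E)).
    + exact: measurable_cabs.
    + by move=> z; rewrite lee_fin cabs_ge0.
    + by move=> x y nH; rewrite (conv_kernel_support sH f0 g0 nH) cabs0.
  - move=> x _; apply: ge0_le_integral => //.
    + by move=> y _; rewrite lee_fin cabs_ge0.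
    + exact: (measurable_cabs (cmeasurable_conv_slice x mfB mgB)).
    + apply: emeasurable_funM; first exact: measurable_cabs.
      exact: (measurable_cabs (cmeasurable_subr x mgB)).
    + by move=> y _; rewrite -EFinM lee_fin cabsM.
rewrite eC lte_mul_pinfty//; first by apply: integral_ge0 => x _.
by rewrite ge0_fin_numE//; apply: integral_ge0 => x _.
Qed.

Lemma conv_baire H f g : sigma_compact_group H -> baire_on H f -> baire_on H g ->
  [/\ {ae mu, forall x, cintegrable mu (fun y => f y * g (x - y))%R},
      cintegrable mu (conv f g) &
      cintegral mu (conv f g) = (cintegral mu f * cintegral mu g)%R].
Proof.
move=> sH bf bg; have oo := conv_kernel_lty sH bf bg.
have [[mf f0 fi] [mg g0 gi] [sc _ _]] := And3 bf bg sH.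
have mfB := cmeasurable_baire_borel hausG mf.
have mgB := cmeasurable_baire_borel hausG mg.
have mk := conv_kernel_measurable hausG sH mfB f0 mg g0.
have [a i e] := haar_Fubini hausG sc mk (conv_kernel_support sH f0 g0) oo.
split; [exact: a|exact: i|].
rewrite [LHS]e; transitivity (cintegral mu (fun y => cintegral mu g * f y)%R).
  congr cintegral; apply/funext => y; rewrite /= cintegralZ.
    rewrite [RHS]mulrC; congr (_ * _)%R.
    exact: (cintegral_preserving (addr_borel (- y)%R) (haar_addr mu (- y)%R) mgB).
  exact: (cintegrable_preserving (addr_borel (- y)%R) (haar_addr mu (- y)%R) gi).
by rewrite (cintegralZ _ fi) [LHS]mulrC.
Qed.

(** [Tonelli_conv] shows that for almost every x the kernel h(x - y) f(z) g(y - z) is absolutely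
    integrable in (y, z). With such an x fixed, the claim is an exchange of two integrals over G *
    G, so no triple product is needed. *)
Lemma convA_baire H f g h : sigma_compact_group H ->
  baire_on H f -> baire_on H g -> baire_on H h ->
  {ae mu, forall x, conv (conv f g) h x = conv f (conv g h) x}.
Proof.
move=> sH bf bg bh.
have [_ ifg _] := conv_baire sH bf bg; have [_ igh _] := conv_baire sH bg bh.
have fgoo := conv_kernel_lty sH bf bg.
have [[mf f0 fi] [mg g0 gi] [mh h0 hi]] := And3 bf bg bh.
have [sc H0 HB] := sH.
have mfB := cmeasurable_baire_borel hausG mf.
have mgB := cmeasurable_baire_borel hausG mg.
have mhB := cmeasurable_baire_borel hausG mh.
have mk := conv_kernel_measurable hausG sH mfB f0 mg g0.
have kH := conv_kernel_support sH f0 g0.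
pose F (y : borel G) := \int[mu]_z (cabs (f z * g (y - z))%R)%:E.
have mF : measurable_fun setT F.
  apply: (haar_Tonelli_measurable mu hausG sc (f := fun z => (cabs (f z.2 * g (z.1 - z.2))%R)%:E)).
  - exact: measurable_cabs.
  - by move=> z; rewrite lee_fin cabs_ge0.
  - by move=> x y nH; rewrite (kH _ _ nH) cabs0.
have Foo : \int[mu]_y F y < +oo by [].
have F0 y : 0 <= F y by apply: integral_ge0 => z _; rewrite lee_fin cabs_ge0.
have FH y : ~ H y -> F y = 0.
  move=> nHy; rewrite /F (eq_integral (cst 0)) ?integral0// => z _.
  by rewrite kH ?cabs0// => -[].
have [mC eC] := Tonelli_conv mu hausG sH mF F0 FH mh h0.
have iC : mu.-integrable setT (fun x : borel G => \int[mu]_y (F y * (cabs (h (x - y)%R))%:E)).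
  apply/integrableP; split => //.
  rewrite (eq_integral (fun x : borel G => \int[mu]_y (F y * (cabs (h (x - y)%R))%:E))).
    have /cintegrableP[_ hoo] := hi; rewrite eC lte_mul_pinfty//.
      by apply: integral_ge0 => // y _.
    by rewrite ge0_fin_numE ?Foo//; apply: integral_ge0 => // y _.
  move=> x _; rewrite gee0_abs//; apply: integral_ge0 => y _.
  by rewrite mule_ge0// lee_fin cabs_ge0.
have := integrable_ae measurableT iC; apply: filterS => x /(_ I) finx.
have {finx}oox : \int[mu]_y (F y * (cabs (h (x - y)%R))%:E) < +oo.
  by rewrite ltey_eq finx.
pose k (z : borel G * borel G) : R[i] := (h (x - z.1) * (f z.2 * g (z.1 - z.2)))%R.
have mkx : cmeasurable k.
  apply: cmeasurableM => //.
  exact: (cmeasurable_comp (cmeasurable_subr x mhB) measurable_fst).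
have kxH y z : ~ (H y /\ H z) -> k (y, z) = 0%R.
  by move=> nH; rewrite /k /= kH// mulr0.
have kxoo : \int[mu]_y \int[mu]_z (cabs (k (y, z)))%:E < +oo.
  apply: le_lt_trans oox; apply: ge0_le_integral => //.
  - by move=> y _; apply: integral_ge0 => z _; rewrite lee_fin cabs_ge0.
  - apply: (haar_Tonelli_measurable mu hausG sc (f := fun z => (cabs (k z))%:E)).
    + exact: measurable_cabs.
    + by move=> z; rewrite lee_fin cabs_ge0.
    + by move=> y z nH; rewrite (kxH _ _ nH) cabs0.
  - apply: emeasurable_funM => //.
    exact: (measurable_cabs (cmeasurable_subr x mhB)).
  move=> y _; rewrite muleC -ge0_integralZl//; last 3 first.
  - exact: (measurable_cabs (cmeasurable_conv_slice y mfB mgB)).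
  - by move=> z _; rewrite lee_fin cabs_ge0.
  - by rewrite lee_fin cabs_ge0.
  apply: ge0_le_integral => //.
  - by move=> z _; rewrite lee_fin cabs_ge0.
  - exact: (measurable_cabs (cmeasurable_comp mkx (pair1_measurable y))).
  - apply: emeasurable_funM => //.
    exact: (measurable_cabs (cmeasurable_conv_slice y mfB mgB)).
  - by move=> z _; rewrite -EFinM lee_fin cabsM.
have [a i e] := haar_Fubini hausG sc mkx kxH kxoo.
have [a' /cintegrable_cmeasurable i2] := haar_Fubini_swap hausG sc mkx kxH kxoo.
transitivity (cintegral mu (fun y => cintegral mu (fun z => k (y, z)))).
  apply: ae_eq_cintegral.
  - exact: (cmeasurable_conv_slice x (cintegrable_cmeasurable ifg) mhB).
  - exact: cintegrable_cmeasurable i.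
  apply: filterS a => y iy.
  have iy' : cintegrable mu (fun z => h (x - y) * (f z * g (y - z)))%R := iy.
  rewrite -[LHS]/(conv f g y * h (x - y))%R mulrC.
  exact: (esym (cintegralZ_slice iy')).
rewrite e.
have mgz (z : G) : cmeasurable (fun y : borel G => (g (y - z) * h ((x : G) - y))%R).
  apply: cmeasurableM; last exact: cmeasurable_subr.
  exact: (cmeasurable_comp mgB (addr_borel (- z)%R)).
(* Substituting y + z for y turns the inner integral into the convolution of g and h at x - z. *)
have eg (z : G) : cintegral mu (fun y => g (y - z) * h ((x : G) - y))%R = conv g h ((x : G) - z)%R.
  rewrite -(cintegral_preserving (addr_borel z) (haar_addr mu z) (mgz z)).
  congr cintegral; apply/funext => y; rewrite addrK; congr (_ * h _)%R.
  by rewrite opprD addrA addrAC.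
apply: ae_eq_cintegral; [exact: i2| |].
  exact: (cmeasurable_conv_slice x mfB (cintegrable_cmeasurable igh)).
apply: filterS a' => z iz; rewrite -eg.
have ek : (fun y => k (y, z)) = (fun y => f z * (g (y - z) * h ((x : G) - y)))%R.
  by apply/funext => y; rewrite /k /=; ring.
by rewrite ek in iz *; exact: cintegralZ_slice.
Qed.

End ConvolutionAlgebra.

(** * Convolution of integrable functions *)

Section ConvolutionGeneral.
Context {R : realType} {G : topologicalZmodType} (mu : haar_measure R G).
Hypothesis hausG : hausdorff_space G.
Hypothesis lcG : locally_compact [set: G].
Implicit Types (f g h : borel G -> R[i]).
Local Notation conv := (conv mu).

(** The three conclusions serve three purposes: the first makes the convolution integral meaningful
    almost everywhere, the second keeps it in L^1, and the third becomes multiplicativity of the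
    Fourier transform once both factors are modulated by a character. *)
Lemma conv_integrable f g : cintegrable mu f -> cintegrable mu g ->
  [/\ {ae mu, forall x, cintegrable mu (fun y => f y * g (x - y))},
      cintegrable mu (conv f g) &
      cintegral mu (conv f g) = cintegral mu f * cintegral mu g].
Proof.
move=> fi gi; have [H [f' [g' [_ [sH [mf f0 ff] [mg g0 gg] _]]]]] :=
  ae_baire3 hausG lcG fi gi gi.
have mfB := cintegrable_cmeasurable fi; have mgB := cintegrable_cmeasurable gi.
have mf' := cmeasurable_baire_borel hausG mf; have mg' := cmeasurable_baire_borel hausG mg.
have bf : baire_on mu H f' by split; [exact: mf|exact: f0|exact: (ae_eq_cintegrable mfB mf' ff fi)].
have bg : baire_on mu H g' by split; [exact: mg|exact: g0|exact: (ae_eq_cintegrable mgB mg' gg gi)].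
have -> : conv f g = conv f' g' by apply/funext; exact: eq_conv.
rewrite (ae_eq_cintegral mfB mf' ff) (ae_eq_cintegral mgB mg' gg).
have [a i e] := conv_baire hausG sH bf bg; split; [|exact: i|exact: e].
apply: filterS a => x; apply: ae_eq_cintegrable.
- exact: (cmeasurable_conv_slice x mf' mg').
- exact: (cmeasurable_conv_slice x mfB mgB).
- by have := conv_slice_ae hausG lcG x ff gg; apply: filterS => y ->.
Qed.

Lemma convA f g h : cintegrable mu f -> cintegrable mu g -> cintegrable mu h ->
  {ae mu, forall x, conv (conv f g) h x = conv f (conv g h) x}.
Proof.
move=> fi gi hi; have [H [f' [g' [h' [sH [mf f0 ff] [mg g0 gg] [mh h0 hh]]]]]] :=
  ae_baire3 hausG lcG fi gi hi.
have mfB := cintegrable_cmeasurable fi; have mgB := cintegrable_cmeasurable gi.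
have mhB := cintegrable_cmeasurable hi.
have mf' := cmeasurable_baire_borel hausG mf; have mg' := cmeasurable_baire_borel hausG mg.
have mh' := cmeasurable_baire_borel hausG mh.
have bf : baire_on mu H f' by split; [exact: mf|exact: f0|exact: (ae_eq_cintegrable mfB mf' ff fi)].
have bg : baire_on mu H g' by split; [exact: mg|exact: g0|exact: (ae_eq_cintegrable mgB mg' gg gi)].
have bh : baire_on mu H h' by split; [exact: mh|exact: h0|exact: (ae_eq_cintegrable mhB mh' hh hi)].
have ifg : cmeasurable (conv f' g') by case: (conv_baire hausG sH bf bg) => _ /cintegrable_cmeasurable.
have igh : cmeasurable (conv g' h') by case: (conv_baire hausG sH bg bh) => _ /cintegrable_cmeasurable.
have refl k : {ae mu, forall x : borel G, k x = k x :> R[i]} by exact: nearW.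
rewrite (_ : conv f g = conv f' g'); last by apply/funext; exact: eq_conv.
rewrite (_ : conv g h = conv g' h'); last by apply/funext; exact: eq_conv.
rewrite (_ : conv (conv f' g') h = conv (conv f' g') h'); last first.
  apply/funext; exact: (eq_conv hausG lcG ifg ifg mhB mh' (refl _) hh).
rewrite (_ : conv f (conv g' h') = conv f' (conv g' h')); last first.
  apply/funext; exact: (eq_conv hausG lcG mfB mf' igh igh ff (refl _)).
exact: (convA_baire hausG sH bf bg bh).
Qed.

(** Linearity of the integral needs both slices to be integrable, hence the restriction to almost
    every x. The case a = 1 gives distributivity and the case f' = 0 compatibility with scalars. *)
Lemma convZDl a f f' g : cintegrable mu f -> cintegrable mu f' -> cintegrable mu g ->
  {ae mu, forall x, conv (fun y => a * f y + f' y) g x = a * conv f g x + conv f' g x}.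
Proof.
move=> fi fi' gi; have [s1 _ _] := conv_integrable fi gi.
have [s2 _ _] := conv_integrable fi' gi; apply: filterS2 s1 s2 => x i1 i2.
have := cintegralD (cintegrableZ a i1) i2; rewrite (cintegralZ a i1) => <-.
by congr cintegral; apply/funext => y; rewrite mulrDl mulrA.
Qed.

(** Since xi(x) = xi(y) xi(x - y), a character distributes over the two factors of the kernel. Both
    the multiplicative action of the characters and the multiplicativity of the Fourier transform
    rest on this. *)
Lemma conv_modulation (xi : dual R G) f g : cintegrable mu f -> cintegrable mu g ->
  {ae mu, forall x, val (xi x) * conv f g x =
    conv (fun y => val (xi y) * f y) (fun y => val (xi y) * g y) x}.
Proof.
move=> fi gi; have [s1 _ _] := conv_integrable fi gi; apply: filterS s1 => x i1.
rewrite -(cintegralZ (val (xi x)) i1); congr cintegral; apply/funext => y.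
rewrite (_ : val (xi x) = val (xi y) * val (xi (x - y))); first by ring.
by rewrite -val_circleM -charD addrC subrK.
Qed.

Lemma conv_translation (a : G) f g (x : G) :
  conv f g (x - a) = conv f (fun y => g (y - a)) x.
Proof. by congr cintegral; apply/funext => y; rewrite addrAC. Qed.

End ConvolutionGeneral.

(** * L^1(G) as a left Heisenberg algebra with reversal *)

Section L1Algebra.
Context {R : realType} {G : topologicalZmodType} (mu : haar_measure R G).
Hypothesis hausG : hausdorff_space G.
Hypothesis lcG : locally_compact [set: G].
Local Notation L1 := (L1 mu).
Local Notation L1_fun := (L1_fun mu).
Implicit Types (f g : L1_fun) (s t : L1).

Lemma L1_classE f g : f =1 g -> L1_class f = L1_class g.
Proof. by move=> fg; apply/L1_classP; apply: nearW. Qed.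

Lemma L1_class_repr f : {ae mu, forall x, L1_repr (L1_class f) x = f x}.
Proof. by apply/L1_classP; rewrite L1_reprK. Qed.

Lemma L1_classZD (a : R[i]) f g : a *: L1_class f + L1_class g = L1_class (a *: f + g).
Proof. by rewrite L1_classD -L1_scale_class. Qed.

Fact L1_conv_subproof f g : conv mu f g \in L1_pred mu.
Proof.
rewrite inE; by have [] := conv_integrable hausG lcG (L1_integrable f) (L1_integrable g).
Qed.
Definition L1_conv s t : L1 :=
  L1_class (MkL1 (L1_conv_subproof (L1_repr s) (L1_repr t))).

Let mL f : cmeasurable f := cintegrable_cmeasurable (L1_integrable f).

Lemma L1_conv_class f g :
  L1_conv (L1_class f) (L1_class g) = L1_class (MkL1 (L1_conv_subproof f g)).
Proof.
apply: L1_classE => x /=; apply: (eq_conv hausG lcG) => //; exact: L1_class_repr.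
Qed.

Lemma is_convolution_L1_conv : is_convolution L1_conv.
Proof.
move=> f g; rewrite L1_conv_class.
have [a _ _] := conv_integrable hausG lcG (L1_integrable f) (L1_integrable g).
by apply: filterS2 a (L1_class_repr (MkL1 (L1_conv_subproof f g))) => x.
Qed.

Lemma L1_commutative_algebra : commutative_algebra L1_conv.
Proof.
split.
- move=> s t u; rewrite -(L1_reprK s) -(L1_reprK t) -(L1_reprK u) !L1_conv_class.
  apply/L1_classP => /=.
  have := convA hausG lcG (L1_integrable (L1_repr s)) (L1_integrable (L1_repr t)) (L1_integrable (L1_repr u)).
  by apply: filterS => x /= ->.
- move=> s t; rewrite -(L1_reprK s) -(L1_reprK t) !L1_conv_class.
  by apply: L1_classE => x /=; exact: convC.
- move=> s t u; rewrite -(L1_reprK s) -(L1_reprK t) -(L1_reprK u).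
  rewrite -L1_classD !L1_conv_class -L1_classD; apply/L1_classP => /=.
  have := convZDl hausG lcG 1 (L1_integrable (L1_repr s)) (L1_integrable (L1_repr t)) (L1_integrable (L1_repr u)).
  apply: filterS => x /=; rewrite mul1r => e; apply: (etrans _ e).
  congr (conv mu _ (L1_repr u) x); apply/funext => y; exact/esym/(f_equal (+%R^~ _))/mul1r.
- move=> a s t; rewrite -(L1_reprK s) -(L1_reprK t).
  rewrite -[a *: L1_class _]/(L1_scale a _) L1_scale_class !L1_conv_class.
  rewrite -[a *: L1_class _]/(L1_scale a _) L1_scale_class; apply/L1_classP => /=.
  have := convZDl hausG lcG a (L1_integrable (L1_repr s)) (L1_integrable 0) (L1_integrable (L1_repr t)).
  apply: filterS => x /= e.
  have c0 : conv mu (fun=> 0) (L1_repr t) x = 0.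
    rewrite /conv (_ : (fun y => _) = fun=> 0); last by apply/funext => y; rewrite mul0r.
    by rewrite /cintegral /Rintegral /= integral0.
  move: e; rewrite c0 addr0 => e; apply: (etrans _ e).
  congr (conv mu _ (L1_repr t) x); apply/funext => y; exact/esym/addr0.
Qed.

Lemma L1_act_class (c : circle R) (x : G) (xi : dual R G) f :
  L1_act (c, x, xi) (L1_class f) = L1_class (val c *:
    MkL1 (L1_translation_subproof x (MkL1 (L1_modulation_subproof xi f)))).
Proof. by rewrite /L1_act L1_modulation_class L1_translation_class -L1_scale_class. Qed.

Lemma L1_left_heisenberg : left_heisenberg_algebra L1_conv (@L1_act R G mu).
Proof.
split.
- exact: L1_commutative_algebra.
- move=> s; rewrite -(L1_reprK s) L1_act_class; apply: L1_classE => y /=.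
  by rewrite fctE scale1r subr0 mul1r.
- move=> [[c x] xi] [[c' x'] xi'] s; rewrite -(L1_reprK s).
  rewrite [L1_act (c', x', xi') _]L1_act_class !L1_act_class.
  apply: L1_classE => y /=; rewrite !fctE /=.
  (* Translating by x' after modulating by xi produces the factor xi(x'), the twist in the
     Heisenberg product. *)
  rewrite (_ : xi (y - x) = (xi x' * xi (y - x - x'))%g); last first.
    by rewrite -charD [x' + _]addrC subrK.
  rewrite opprD addrA /=; rewrite /GRing.scale /=; ring.
- move=> [[c x] xi] a s t; rewrite -(L1_reprK s) -(L1_reprK t) L1_classZD !L1_act_class.
  rewrite L1_classZD; apply: L1_classE => y /=; rewrite !fctE /= /GRing.scale /=; ring.
- move=> c s; rewrite -(L1_reprK s) L1_act_class -[RHS]/(L1_scale _ _) L1_scale_class.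
  by apply: L1_classE => y /=; rewrite !fctE /= subr0 mul1r.
(* Translation passes directly into the second factor of the convolution integral; commutativity
   moves it to the first. *)
- move=> x s t; rewrite (calg_mulC L1_commutative_algebra s) (calg_mulC L1_commutative_algebra _ t).
  rewrite -(L1_reprK s) -(L1_reprK t) L1_conv_class.
  rewrite [X in L1_conv _ X]L1_act_class L1_act_class L1_conv_class.
  apply: L1_classE => y /=; rewrite !fctE /= scale1r mul1r conv_translation.
  congr (conv mu (L1_repr t) _ y); apply/funext => z; by rewrite scale1r mul1r.
- move=> xi s t; rewrite -(L1_reprK s) -(L1_reprK t) L1_conv_class.
  rewrite [L1_act _ (L1_class (L1_repr s))]L1_act_class.
  rewrite [L1_act _ (L1_class (L1_repr t))]L1_act_class L1_act_class L1_conv_class.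
  apply/L1_classP.
  have h := conv_modulation hausG lcG xi (L1_integrable (L1_repr s)) (L1_integrable (L1_repr t)).
  apply: (@filterS (borel G) (almost_everywhere mu) _ _ _ _ h) => y {}h; rewrite /= !fctE /= scale1r subr0 h.
  congr (conv mu _ _ y); apply/funext => z; by rewrite scale1r subr0.
Qed.

(** Inversion invariance keeps the reflected function integrable; it is used again to make
    reflection well defined on classes. *)
Fact L1_reversal_subproof f : (fun y => f (- y)) \in L1_pred mu.
Proof.
rewrite inE; exact: (cintegrable_preserving (@oppr_borel G) (haar_oppr mu hausG lcG) (L1_integrable f)).
Qed.
Definition L1_reversal s : L1 := L1_class (MkL1 (L1_reversal_subproof (L1_repr s))).

Lemma L1_reversal_class f :
  L1_reversal (L1_class f) = L1_class (MkL1 (L1_reversal_subproof f)).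
Proof.
apply/L1_classP => /=.
exact: (ae_preserving (@oppr_borel G) (haar_oppr mu hausG lcG) (L1_class_repr f)).
Qed.

Lemma is_L1_reversal_L1_reversal : is_L1_reversal L1_reversal.
Proof. by move=> f; rewrite L1_reversal_class; exact: L1_class_repr. Qed.

Lemma L1_left_reversal : left_reversal L1_conv (@L1_act R G mu) L1_reversal.
Proof.
split.
- split=> [a s t|s t]; rewrite -(L1_reprK s) -(L1_reprK t).
    by rewrite L1_classZD !L1_reversal_class L1_classZD; apply: L1_classE.
  rewrite L1_conv_class (L1_reversal_class (L1_repr s)) (L1_reversal_class (L1_repr t)).
  rewrite L1_reversal_class L1_conv_class; apply: L1_classE => x /=.
  exact: conv_oppr.
- move=> s; rewrite -(L1_reprK s) !L1_reversal_class; apply: L1_classE => x /=.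
  by rewrite opprK.
- move=> x s; rewrite -(L1_reprK s) [L1_act (position _ x) _]L1_act_class.
  rewrite !L1_reversal_class L1_act_class; apply: L1_classE => y /=.
  by rewrite !fctE /= !mul1r opprK opprD.
- move=> xi s; rewrite -(L1_reprK s) [L1_act (momentum _ xi) _]L1_act_class.
  rewrite !L1_reversal_class L1_act_class; apply: L1_classE => y /=.
  by rewrite !fctE /= !subr0 -[xi (- y)]/(@duality R G xi (- y)) bicharNr.
Qed.

End L1Algebra.

(** * Compactness in the dual group *)

(** If a finer proper filter contained A while F lacked the preimage of A, then F would contain the
    preimage of the complement, and the finer filter both A and its complement. *)
Lemma ultra_fmap (T U : Type) (f : T -> U) (F : set_system T) :
  UltraFilter F -> UltraFilter (f @ F).
Proof.
move=> FU; apply: Build_UltraFilter => H PH sub.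
apply/seteqP; split=> [A HA|]; last exact: sub.
have [//|FnA] := in_ultra_setVsetC (f @^-1` A) FU.
have /sub HnA : (f @ F) (~` A) by [].
have FH : Filter H by case: PH.
by have [x []] := @filter_ex _ H PH _ (@filterI _ H FH _ _ HA HnA).
Qed.

Lemma ultra_segment_cvg (R : realType) (T : Type) (r : T -> R) (F : set_system T) (a b : R) :
  UltraFilter F -> (forall t, a <= r t <= b) ->
  exists l : R, forall e, 0 < e -> F [set t | `|r t - l| < e].
Proof.
move=> FU rab; have FU' := ultra_fmap r FU; have FF : ProperFilter F := ultra_proper.
have := @segment_compact R a b; rewrite compact_ultra => /(_ _ FU')[|l [_ rl]].
  by apply: (@filterE _ F) => t; rewrite /= in_itv /=.
exists l => e e0.
have h : F (r @^-1` ball l e) := rl _ (@nbhsx_ballx _ _ l e e0).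
by apply: (@filterS _ F _ _ _ _ h) => t; rewrite /ball /= distrC.
Qed.

Section DualCompact.
Context {R : realType} {G : topologicalZmodType}.
Local Notation dual := (dual R G).

Lemma posC_real (e : R[i]) : 0 < e -> exists2 r : R, 0 < r & e = r%:C%C.
Proof.
case: e => a b; rewrite ltcE /= => /andP[/eqP -> a0].
by exists a.
Qed.

(** Real and imaginary parts converge separately in the compact interval [-1, 1]. The limit is so
    far only a complex number at each point; that it is unimodular and multiplicative is checked
    where it is used. *)
Lemma ultra_dual_cvg (F : set_system dual) : UltraFilter F ->
  exists z : G -> R[i], forall x (e : R[i]), 0 < e ->
    F [set xi : dual | `|val (xi x) - z x| < e].
Proof.
move=> FU; suff /choice[z hz] (x : G) : exists zx, forall e : R[i], 0 < e ->
    F [set xi : dual | `|val (xi x) - zx| < e] by exists z.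
have bnd (u : R) : `|u| <= 1 -> -1 <= u <= 1 by rewrite ler_norml.
have [|a ha] := @ultra_segment_cvg R dual (fun xi => complex.Re (val (xi x))) F (-1) 1 FU.
  by move=> xi; apply: bnd; case: (char_Re_Im xi).
have [|b hb] := @ultra_segment_cvg R dual (fun xi => complex.Im (val (xi x))) F (-1) 1 FU.
  by move=> xi; apply: bnd; case: (char_Re_Im xi).
exists (a +i* b)%C => e /posC_real[r r0 ->].
have r20 : 0 < r / 2 by rewrite divr_gt0.
have FF : ProperFilter F := ultra_proper.
apply: (@filterS2 _ F _ _ _ _ _ (ha _ r20) (hb _ r20)) => xi /= h1 h2.
apply: le_lt_trans (normc_le_cabs _) _; rewrite ltcR /cabs.
move: h1 h2; case: (val (xi x)) => u v /= h1 h2.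
by rewrite [ltRHS]splitr ltrD.
Qed.

Lemma normc_small (w : R[i]) : (forall e, 0 < e -> `|w| <= e) -> w = 0.
Proof.
move=> h; apply/eqP; rewrite -normr_le0; apply/ler_addgt0Pr => e e0.
by rewrite add0r; exact: h.
Qed.

(* An ultrafilter on this set converges pointwise to a homomorphism; equicontinuity
   makes the limit continuous and the convergence uniform on compact sets. *)
Lemma dual_equicontinuous_compact (V : R -> set G) :
  (forall d, 0 < d -> nbhs 0 (V d)) ->
  compact [set xi : dual | forall d, 0 < d -> forall x, V d x ->
    `|1 - val (xi x)| <= d%:C%C].
Proof.
move=> V0; set S := [set _ | _]; rewrite compact_ultra => F FU FS.
have FF : ProperFilter F := ultra_proper.
have FI (A B : set dual) : F A -> F B -> F (A `&` B) by exact: filterI.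
have [z hz] := ultra_dual_cvg FU.
have z1 x : `|z x| == 1.
  rewrite -subr_eq0; apply/eqP/normc_small => e /(hz x) /filter_ex[xi /= /ltW].
  apply: le_trans; have := ler_dist_dist (z x) (val (xi x)).
  by rewrite circle_norm => /le_trans; apply; rewrite (distrC (z x)).
have e30 (e : R[i]) : 0 < e -> 0 < e / 3 by move=> ?; rewrite divr_gt0.
have zD x y : z (x + y) = z x * z y.
  apply/eqP; rewrite -subr_eq0; apply/eqP/normc_small => e /e30 e3.
  have /filter_ex[xi [[/= h1 h2] h3]] := FI _ _ (FI _ _ (hz x _ e3) (hz y _ e3)) (hz (x + y) _ e3).
  have -> : z (x + y) - z x * z y = (val (xi x) - z x) * val (xi y)
      + z x * (val (xi y) - z y) - (val (xi (x + y)) - z (x + y)).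
    by rewrite charD val_circleM; ring.
  have -> : e = e / 3 + e / 3 + e / 3 by field.
  apply: le_trans (ler_normB _ _) _; apply: lerD; last exact: ltW.
  apply: le_trans (ler_normD _ _) _.
  by rewrite !normrM circle_norm (eqP (z1 x)) mulr1 mul1r lerD// ltW.
pose chi x : circle R := exist _ (z x) (z1 x).
have chiD x y : chi (x + y) = (chi x * chi y)%g by apply/val_inj; exact: zD.
have chiV d x : 0 < d -> V d x -> `|1 - z x| <= d%:C%C.
  move=> d0 Vx; apply/ler_addgt0Pr => e e0.
  have /filter_ex[xi [/= Sxi h]] := FI _ _ FS (hz x _ e0).
  have -> : 1 - z x = (1 - val (xi x)) + (val (xi x) - z x) by ring.
  by apply: le_trans (ler_normD _ _) _; apply: lerD; [exact: (Sxi d d0 x Vx)|exact: ltW].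
have Vnear d x : 0 < d -> \forall y \near x, V d (y - x).
  move=> d0; have := @addr_continuous G (- x) x (V d); apply.
  by rewrite /= subrr; exact: V0.
have chi_continuous : continuous chi.
  apply/continuous_circleP => x.
  apply: (iffRL (@cvgrPdist_lt _ R[i]^o _ (nbhs x) (nbhs_filter x) _ _)) => e.
  move=> /posC_real[r r0 ->].
  have r20 : 0 < r / 2 by rewrite divr_gt0.
  apply: filterS (Vnear _ x r20) => y Vy.
  have -> : val (chi x) - val (chi y) = z x * (1 - z (y - x)).
    by rewrite /= mulrBr mulr1 -zD [x + _]addrC subrK.
  rewrite normrM (eqP (z1 x)) mul1r; apply: le_lt_trans (chiV _ _ r20 Vy) _.
  by rewrite ltcR ltr_pdivrMr// mulr_natr mulr2n ltrDl.
pose chi' := Character chi_continuous chiD.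
exists chi'; split; first by move=> d d0 x; exact: chiV.
apply/cvg_dualP => K e /compact_near_coveringP cK e0 /=.
have e3 := e30 _ e0; have [r r0 er] := posC_real e3.
apply: (cK _ F (fun (eta : dual) x => `|z x - val (eta x)| < e)) => x Kx.
exists ([set y | V r (y - x)], S `&` [set eta : dual | `|val (eta x) - z x| < e / 3]).
  by split => /=; [exact: Vnear|exact: (FI _ _ FS (hz x _ e3))].
move=> [y eta] /= [Vy [Seta h]].
(* Equicontinuity bounds the change of z and of eta from x to y by e/3 each, and at x they differ by
   less than e/3. The bound holds on a neighbourhood of x times one set of the filter, as
   near-covering compactness requires. *)
have -> : z y - val (eta y) = - z x * (1 - z (y - x)) + val (eta x) * (1 - val (eta (y - x)))
    - (val (eta x) - z x).
  have -> : z y = z x * z (y - x) by rewrite -zD [x + _]addrC subrK.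
  have -> : val (eta y) = val (eta x) * val (eta (y - x)).
    by rewrite -val_circleM -charD [x + _]addrC subrK.
  by ring.
have -> : e = e / 3 + e / 3 + e / 3 by field.
apply: le_lt_trans (ler_normB _ _) _; apply: ler_ltD => //.
apply: le_trans (ler_normD _ _) _.
rewrite !normrM normrN circle_norm (eqP (z1 x)) !mul1r er lerD//.
  exact: chiV.
exact: Seta.
Qed.

End DualCompact.

(** * The Riemann-Lebesgue lemma *)

Section RiemannLebesgue.
Context {R : realType} {G : topologicalZmodType} (mu : haar_measure R G).
Hypothesis hausG : hausdorff_space G.
Local Notation dual := (dual R G).
Implicit Types (f g : borel G -> R[i]).

Definition fourier f (xi : dual) : R[i] := cintegral mu (fun y => val (xi y) * f y).

Lemma cabs_char (xi : dual) (y : G) : cabs (val (xi y)) <= 2.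
Proof.
have [_ _ bR bI] := char_Re_Im xi.
by rewrite /cabs -[leRHS]/(1 + 1) lerD.
Qed.

Lemma cintegrable_char (xi : dual) f : cintegrable mu f ->
  cintegrable mu (fun y => val (xi y) * f y).
Proof.
move=> fi; have fL : f \in L1_pred mu by rewrite inE.
by have := L1_modulation_subproof xi (MkL1 fL); rewrite inE.
Qed.

Lemma fourierZD (a : R[i]) f g (xi : dual) : cintegrable mu f -> cintegrable mu g ->
  fourier (fun y => a * f y + g y) xi = a * fourier f xi + fourier g xi.
Proof.
move=> fi gi; have i1 := cintegrable_char xi fi; have i2 := cintegrable_char xi gi.
rewrite /fourier -(cintegralZ a i1) -(cintegralD (cintegrableZ a i1) i2).
by congr cintegral; apply/funext => y; ring.
Qed.

Lemma fourier0 (xi : dual) : fourier (fun=> 0) xi = 0.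
Proof.
rewrite /fourier (_ : (fun y => _) = fun=> 0); last by apply/funext => y; rewrite mulr0.
by rewrite /cintegral /Rintegral /= integral0.
Qed.

(** The factor 2 is the cost of [cabs], which is bounded by 2 on the unit circle. *)
Lemma cabs_fourier_le f (xi : dual) : cintegrable mu f ->
  ((cabs (fourier f xi))%:E <= 2%:E * \int[mu]_y (cabs (f y))%:E)%E.
Proof.
move=> fi; have i := cintegrable_char xi fi; have mf := cintegrable_cmeasurable fi.
apply: le_trans (cabs_cintegral i) _.
rewrite -ge0_integralZl//; last 2 first.
- exact: measurable_cabs.
- by move=> y _; rewrite lee_fin cabs_ge0.
apply: ge0_le_integral => //.
- by move=> y _; rewrite lee_fin cabs_ge0.
- exact: (measurable_cabs (cintegrable_cmeasurable i)).
- by apply: emeasurable_funM => //; exact: measurable_cabs.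
- move=> y _; rewrite -EFinM lee_fin; apply: le_trans (cabsM _ _) _.
  by rewrite ler_wpM2r ?cabs_ge0// cabs_char.
Qed.

Lemma C0_uniform_closed (X : topologicalType) (h : X -> R[i]) :
  (forall e : R, 0 < e -> exists2 g, g \in C0_pred R X & forall x, cabs (h x - g x) <= e) ->
  h \in C0_pred R X.
Proof.
move=> approx; rewrite inE; split.
  move=> x; apply: (iffRL (@cvgrPdist_lt _ R[i]^o _ (nbhs x) (nbhs_filter x) _ _)) => e.
  move=> /posC_real[r r0 ->]; have r30 : 0 < r / 3 by rewrite divr_gt0.
  have [g] := approx _ r30; rewrite inE => -[cg _] hg.
  have r3C : 0 < (r / 3)%:C%C by rewrite ltcR.
  have near_g := iffLR (@cvgrPdist_lt _ R[i]^o _ (nbhs x) (nbhs_filter x) _ _) (cg x) _ r3C.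
  apply: (@filterS _ (nbhs x) _ _ _ _ near_g) => y gxy.
  have -> : h x - h y = (h x - g x) + (g x - g y) - (h y - g y) by ring.
  have -> : r%:C%C = (r / 3)%:C%C + (r / 3)%:C%C + (r / 3)%:C%C.
    by rewrite -!rmorphD; congr (_%:C)%C; field.
  apply: le_lt_trans (ler_normB _ _) _; apply: ltr_leD; last first.
    by apply: le_trans (normc_le_cabs _) _; rewrite lecR.
  apply: le_lt_trans (ler_normD _ _) _; apply: ler_ltD => //.
  by apply: le_trans (normc_le_cabs _) _; rewrite lecR.
move=> e /posC_real[r r0 ->]; have r20 : 0 < r / 2 by rewrite divr_gt0.
have [g] := approx _ r20; rewrite inE => -[_ vg] hg.
have r2C : 0 < (r / 2)%:C%C by rewrite ltcR.
have [K cK gK] := vg _ r2C; exists K => // x /gK gx.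
have -> : h x = (h x - g x) + g x by ring.
have -> : r%:C%C = (r / 2)%:C%C + (r / 2)%:C%C by rewrite -!rmorphD -splitr.
apply: le_lt_trans (ler_normD _ _) _; apply: ler_ltD => //.
by apply: le_trans (normc_le_cabs _) _; rewrite lecR.
Qed.

(** The transform is bounded from the L^1 norm to the uniform norm and C_0 is uniformly closed, so
    the functions with transform in C_0 are closed in L^1. This is the density step, from compact
    sets to sets of finite measure and from simple to integrable functions. *)
Lemma fourier_C0_approx f : cintegrable mu f ->
  (forall e : R, 0 < e -> exists g, [/\ cintegrable mu g, fourier g \in C0_pred R dual &
    (\int[mu]_y (cabs (f y - g y))%:E <= e%:E)%E]) -> fourier f \in C0_pred R dual.
Proof.
move=> fi approx; apply: C0_uniform_closed => e e0.
have [|g [gi gC gf]] := approx (e / 2); first by rewrite divr_gt0.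
exists (fourier g) => // xi.
have fg : cintegrable mu (fun y => -1 * g y + f y) by exact: cintegrableD (cintegrableZ _ gi) fi.
have -> : fourier f xi - fourier g xi = fourier (fun y => -1 * g y + f y) xi.
  by rewrite fourierZD//; ring.
rewrite -lee_fin; apply: le_trans (cabs_fourier_le xi fg) _.
have -> : e%:E = (2%:E * (e / 2)%:E)%E by rewrite -EFinM; congr EFin; field.
apply: lee_wpmul2l; first by rewrite lee_fin.
rewrite (eq_integral (fun y => (cabs (f y - g y))%:E))// => y _.
by congr (cabs _)%:E; ring.
Qed.

Lemma fourier_C0ZD (a : R[i]) f g : cintegrable mu f -> cintegrable mu g ->
  fourier f \in C0_pred R dual -> fourier g \in C0_pred R dual ->
  fourier (fun y => a * f y + g y) \in C0_pred R dual.
Proof.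
move=> fi gi fC gC; have h := (@C0_submod_closed R dual).2 a _ _ fC gC.
rewrite (_ : fourier (fun y => _) = a *: fourier f + fourier g); first exact: h.
by apply/funext => xi; exact: fourierZD.
Qed.

Definition cindic (A : set G) (y : borel G) : R[i] := ((\1_A y : R)%:C)%C.

Lemma integral_cabs_cindic (A : set (borel G)) : measurable A ->
  (\int[mu]_y (cabs (cindic A y))%:E = mu A)%E.
Proof.
move=> mA; transitivity (\int[mu]_y (\1_A y : R)%:E)%E; last first.
  by rewrite integral_indic// setIT.
by apply: eq_integral => y _; rewrite /cabs /cindic /= normr0 addr0 ger0_norm// indicE.
Qed.

Lemma cintegrable_cindic (A : set (borel G)) : measurable A -> (mu A < +oo)%E ->
  cintegrable mu (cindic A).
Proof.
move=> mA Aoo; apply/cintegrableP; split; last by rewrite integral_cabs_cindic.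
by split; [exact: measurable_indic|exact: measurable_cst].
Qed.


(** For x near 0 the translate x + K remains in an open U with mu(U - K) < e/2. The symmetric
    difference of K and x + K lies in the union of U - K and U - (x + K), which have equal
    measure. *)
Lemma compact_translation_near (K : set (borel G)) (e : R) : compact (K : set G) -> 0 < e ->
  \forall x \near nbhs (0 : G),
    (\int[mu]_y (cabs (cindic K y - cindic K (y - x)%R))%:E <= e%:E)%E.
Proof.
move=> cK e0; have e20 : 0 < e / 2 by rewrite divr_gt0.
have mK := compact_measurable hausG cK.
have [U oU [KU Uoo UK]] := haar_open_approx mK (haar_compact mu cK) e20.
have mU := open_measurable_borel oU.
apply: (@filterS _ (nbhs (0 : G)) _ _ _ _ (compact_nbhs_add cK oU KU)) => x Kx.
pose L : set (borel G) := (fun y => y - x) @^-1` K.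
have mL : measurable L by rewrite -[X in measurable X]setTI; exact: addr_borel.
have LU : L `<=` U by move=> y Ly; rewrite -(subrK x y); exact: Kx.
have muL : mu L = mu K by exact: haar_addr.
have UL : mu (U `\` L) = mu (U `\` K).
  rewrite measureD// (setIidr LU) [RHS]measureD// (setIidr KU).
  by congr (_ - _)%E; exact: muL.
have mI (A : set (borel G)) : measurable A -> measurable_fun setT (fun y => (\1_A y : R)%:E).
  by move=> mA; apply/measurable_EFinP; exact: measurable_indic.
have mc (A : set (borel G)) : measurable A -> cmeasurable (cindic A : borel G -> R[i]).
  by move=> mA; split; [exact: measurable_indic|exact: measurable_cst].
apply: (@le_trans _ _ (\int[mu]_y ((\1_(U `\` K) y : R)%:E + (\1_(U `\` L) y : R)%:E))%E).
  apply: ge0_le_integral => //.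
  - by move=> y _; rewrite lee_fin cabs_ge0.
  - have [m1 m2] := mc K mK; have [m3 m4] := mc L mL.
    apply: measurable_cabs; split.
      rewrite (_ : (fun y => _) = (fun y => complex.Re (cindic K y)) \-
        (fun y => complex.Re (cindic L y)))%R//; exact: measurable_funB.
    by rewrite (_ : (fun y => _) = cst 0)//; apply/funext => y /=; rewrite subr0.
  - by apply: emeasurable_funD; apply: mI; exact: measurableD.
  - move=> y _; rewrite -EFinD lee_fin /cabs /cindic /= subr0 normr0 addr0 !indicE.
    have -> : (y - x \in K) = (y \in L) by apply/idP/idP; rewrite !inE.
    have [yK|yK] := boolP (y \in K); have [yL|yL] := boolP (y \in L).
    + by rewrite subrr normr0 addr_ge0.
    + rewrite subr0 normr1 (@mem_set _ (U `\` L) y) ?lerDr//.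
      by split; [apply: KU; exact: set_mem yK|move=> Ly; move: yL; rewrite mem_set].
    + rewrite sub0r normrN normr1 (@mem_set _ (U `\` K) y) ?lerDl//.
      by split; [apply: LU; exact: set_mem yL|move=> Ky; move: yK; rewrite mem_set].
    + by rewrite subrr normr0 addr_ge0.
rewrite ge0_integralD//; [|exact: (mI _ (measurableD mU mK))|exact: (mI _ (measurableD mU mL))].
rewrite (integral_indic mu measurableT (measurableD mU mK)).
rewrite (integral_indic mu measurableT (measurableD mU mL)).
by rewrite !setIT UL [e in leRHS]splitr EFinD leeD// ltW.
Qed.

Lemma fourier_compact_continuous (K : set (borel G)) : compact (K : set G) ->
  continuous (fourier (cindic K) : dual -> R[i]^o).
Proof.
move=> cK xi; have mK := compact_measurable hausG cK.
have Koo := haar_compact mu cK.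
have iK := cintegrable_cindic mK Koo.
apply: (iffRL (@cvgrPdist_lt _ R[i]^o _ (nbhs xi) (nbhs_filter xi) _ _)) => e.
move=> /posC_real[r r0 ->].
have m0 : 0 <= fine (mu K) by rewrite fine_ge0.
(* Characters within c of each other on K have transforms within 2 c mu(K), the 2 coming from
   [cabs_le_normc]. The added 1 keeps the denominator positive when K is null and makes the bound
   strict. *)
pose c := r / (2 * (fine (mu K) + 1)).
have c0 : 0 < c by rewrite divr_gt0// mulr_gt0// ltr_wpDl.
have c0C : 0 < c%:C%C by rewrite ltcR.
have near_c := iffLR (@cvg_dualP _ _ _ xi (nbhs_filter xi)) (fun A h => h) K _ cK c0C.
apply: (@filterS _ (nbhs xi) _ _ _ _ near_c) => eta hK.
have i1 := cintegrable_char xi iK; have i2 := cintegrable_char eta iK.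
have i3 := cintegrableD i1 (cintegrableZ (-1) i2).
have -> : fourier (cindic K) xi - fourier (cindic K) eta =
    cintegral mu (fun y => val (xi y) * cindic K y + -1 * (val (eta y) * cindic K y)).
  by rewrite (cintegralD i1 (cintegrableZ (-1) i2)) (cintegralZ (-1) i2) mulN1r.
apply: le_lt_trans (normc_le_cabs _) _; rewrite ltcR -lte_fin.
apply: le_lt_trans (cabs_cintegral i3) _.
apply: (@le_lt_trans _ _ (\int[mu]_y ((2 * c)%:E * (\1_K y : R)%:E))%E).
  apply: ge0_le_integral => //.
  - by move=> y _; rewrite lee_fin cabs_ge0.
  - exact: (measurable_cabs (cintegrable_cmeasurable i3)).
  - by apply: emeasurable_funM => //; apply/measurable_EFinP; exact: measurable_indic.
  - move=> y _; rewrite -EFinM lee_fin mulN1r -mulrBl.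
    have [yK|yK] := pselect (K y); last first.
      by rewrite /cindic indicE memNset//= mulr0 cabs0 mulr0.
    rewrite /cindic indicE mem_set//= mulr1 mulr1 -lecR.
    apply: le_trans (cabs_le_normc _) _.
    have -> : (2 * c)%:C%C = 2 * c%:C%C :> R[i] by rewrite rmorphM rmorph_nat.
    by apply: ler_wpM2l => //; apply: ltW; exact: hK.
rewrite ge0_integralZl//; last 2 first.
- by apply/measurable_EFinP; exact: measurable_indic.
- by rewrite lee_fin mulr_ge0// ltW.
rewrite integral_indic// setIT -[mu K]fineK ?ge0_fin_numE// -EFinM lte_fin.
rewrite /c; set m := fine _; rewrite -/m in m0.
rewrite (_ : 2 * (r / (2 * (m + 1))) * m = r * (m / (m + 1))); last first.
  by field; rewrite gt_eqF// ltr_wpDl.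
by rewrite gtr_pMr// ltr_pdivrMr ?mul1r ?ltrDl// ltr_wpDl.
Qed.

Lemma fourier_translation f (xi : dual) (x : G) : cintegrable mu f ->
  (1 - val (xi x)) * fourier f xi = fourier (fun y => -1 * f (y - x) + f y) xi.
Proof.
move=> fi; have fx : cintegrable mu (fun y => f (y - x)).
  exact: (cintegrable_preserving (addr_borel (- x)) (haar_addr mu (- x)) fi).
rewrite fourierZD// mulrBl mul1r mulN1r addrC; congr (- _ + _).
rewrite /fourier -(cintegralZ (val (xi x)) (cintegrable_char xi fi)).
have mx := cintegrable_cmeasurable (cintegrable_char xi fx).
rewrite -[RHS](cintegral_preserving (addr_borel x) (haar_addr mu x) mx).
congr cintegral; apply/funext => y.
by rewrite addrK charD val_circleM; ring.
Qed.

Lemma fourier_compact_C0 (K : set (borel G)) : compact (K : set G) ->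
  fourier (cindic K) \in C0_pred R dual.
Proof.
move=> cK; rewrite inE; split; first exact: fourier_compact_continuous.
have mK := compact_measurable hausG cK.
have iK := cintegrable_cindic mK (haar_compact mu cK).
move=> e /posC_real[r r0 ->].
(* With the factor 2 of [cabs_fourier_le], the bound d r / 2 gives |1 - xi(x)| |F(1_K)(xi)| <= d r
   on V d. Where the transform is at least r, division by r leaves |1 - xi(x)| <= d. *)
pose V (d : R) : set G := [set x |
  (\int[mu]_y (cabs (cindic K y - cindic K (y - x)%R))%:E <= (d * r / 2)%:E)%E].
have V0 d : 0 < d -> nbhs 0 (V d).
  by move=> d0; apply: compact_translation_near => //; rewrite divr_gt0// mulr_gt0.
exists [set xi : dual | forall d, 0 < d -> forall x, V d x -> `|1 - val (xi x)| <= d%:C%C].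
  exact: dual_equicontinuous_compact.
move=> xi nS; rewrite real_ltNge ?normr_real//; last first.
  by rewrite complex_real.
apply/negP => rF; apply: nS => d d0 x Vx.
have rC : 0 < r%:C%C :> R[i] by rewrite ltcR.
rewrite -(ler_pM2r rC); apply: le_trans (ler_wpM2l (normr_ge0 _) rF) _.
rewrite -normrM (fourier_translation xi x iK) -rmorphM.
apply: le_trans (normc_le_cabs _) _; rewrite lecR -lee_fin.
have fi : cintegrable mu (fun y => -1 * cindic K (y - x) + cindic K y).
  apply: cintegrableD => //; apply: cintegrableZ.
  exact: (cintegrable_preserving (addr_borel (- x)) (haar_addr mu (- x)) iK).
apply: le_trans (cabs_fourier_le xi fi) _.
have -> : (d * r)%:E = (2%:E * (d * r / 2)%:E)%E by rewrite -EFinM; congr EFin; field.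
apply: lee_wpmul2l; first by rewrite lee_fin.
rewrite (eq_integral (fun y => (cabs (cindic K y - cindic K (y - x)%R))%:E))// => y _.
by congr (cabs _)%:E; rewrite mulN1r addrC.
Qed.

End RiemannLebesgue.

(** * From compact sets to all integrable functions *)

Section FourierC0.
Import HBSimple.
Context {R : realType} {G : topologicalZmodType} (mu : haar_measure R G).
Hypothesis hausG : hausdorff_space G.
Local Notation dual := (dual R G).
Implicit Types (f g : borel G -> R[i]) (E : set (borel G)).
Local Notation fourier := (fourier mu).

Lemma fourier_cindic_C0 E : measurable E -> (mu E < +oo)%E ->
  fourier (cindic E) \in C0_pred R dual.
Proof.
move=> mE Eoo; apply: fourier_C0_approx => [|e e0]; first exact: cintegrable_cindic.
have [K [U [cK oU KE EU UK]]] := haar_regular hausG mE Eoo e0.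
have mK := compact_measurable hausG cK; have mU := open_measurable_borel oU.
have mEK : measurable (E `\` K) := measurableD mE mK.
exists (cindic K); split.
- exact: (cintegrable_cindic mK (haar_compact mu cK)).
- exact: fourier_compact_C0.
rewrite (eq_integral (fun y => (cabs (cindic (E `\` K) y : R[i]))%:E)); last first.
  move=> y _; congr (cabs _)%:E; rewrite /cindic -rmorphB /=; congr (_%:C)%C.
  rewrite !indicE in_setD; have [yK|yK] := boolP (y \in K).
    by rewrite (mem_set (KE _ (set_mem yK))) subrr.
  by rewrite subr0 andbT.
rewrite integral_cabs_cindic//; apply: ltW; apply: le_lt_trans UK.
by apply: le_measure; rewrite ?inE//; [exact: measurableD|exact: setSD].
Qed.

(** Integrability is carried along because additivity of the transform requires it at each step of
    the induction over a finite sum. *)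
Definition fourier_C0_fun f := cintegrable mu f /\ fourier f \in C0_pred R dual.

Lemma fourier_C0_fun0 : fourier_C0_fun (fun=> 0).
Proof.
split; first by split; exact: integrable0.
rewrite (_ : fourier (fun=> 0) = 0); first exact: rpred0.
by apply/funext => xi; exact: fourier0.
Qed.

Lemma fourier_C0_funZD (a : R[i]) f g : fourier_C0_fun f -> fourier_C0_fun g ->
  fourier_C0_fun (fun y => a * f y + g y).
Proof.
move=> [fi fC] [gi gC]; split; last exact: fourier_C0ZD.
exact: cintegrableD (cintegrableZ a fi) gi.
Qed.

Lemma fourier_C0_sfun (g : {sfun borel G >-> R}) :
  mu.-integrable setT (EFin \o g) -> fourier_C0_fun (fun y => ((g y)%:C)%C).
Proof.
move=> ig; rewrite (_ : (fun y => _) =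
  (fun y => \sum_(r <- finmap.enum_fset (fset_set (range g))) (r%:C)%C * cindic (g @^-1` [set r]) y)).
  elim: (finmap.enum_fset _) => [|r s IH].
    rewrite (_ : (fun y => _) = fun=> 0); first exact: fourier_C0_fun0.
    by apply/funext => y; rewrite big_nil.
  rewrite (_ : (fun y => _) = (fun y => (r%:C)%C * cindic (g @^-1` [set r]) y +
    \sum_(r <- s) (r%:C)%C * cindic (g @^-1` [set r]) y)); last first.
    by apply/funext => y; rewrite big_cons.
  (* The level set of the value 0 may have infinite measure, so its indicator need not be
     integrable; its term is dropped. *)
  have [->|r0] := eqVneq r 0.
    by under eq_fun do rewrite mul0r add0r.
  apply: fourier_C0_funZD => //.
  have mr : measurable (g @^-1` [set r] : set (borel G)) by exact: measurable_sfunP.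
  have roo : (mu (g @^-1` [set r]) < +oo)%E.
    have r0' : 0 < `|r| by rewrite normr_gt0.
    have [ml loo] := integrable_level_lty ig r0'.
    apply: le_lt_trans loo; apply: le_measure; rewrite ?inE//.
    by move=> y /= ->.
  by split; [exact: cintegrable_cindic|exact: fourier_cindic_C0].
apply/funext => y; rewrite [in LHS]fimfunE fsbig_finite//= rmorph_sum.
by apply: eq_bigr => r _; rewrite rmorphM.
Qed.

Lemma fourier_C0_real (h : borel G -> R) : mu.-integrable setT (EFin \o h) ->
  fourier_C0_fun (fun y => ((h y)%:C)%C).
Proof.
move=> ih; have hi : cintegrable mu (fun y => ((h y)%:C)%C).
  by split => //; exact: integrable0.
split=> //; apply: fourier_C0_approx => // e e0.
have [g [gi _ gh]] := approximation_sfun_integrable measurableT ih.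
have : \forall n \near \oo, (\int[mu]_z `|(h z)%:E - (g n z)%:E| < e%:E)%E.
  have /gh : nbhs (0%E : \bar R) [set u : \bar R | (u < e%:E)%E].
    by apply: open_nbhs_nbhs; split; [exact: open_ereal_lt_ereal|rewrite /= lte_fin].
  by [].
move=> [n _ /(_ n (leqnn n)) /= hn].
have [gci gC] := fourier_C0_sfun (gi n).
exists (fun y => ((g n y)%:C)%C); split=> //; apply: ltW; apply: le_lt_trans hn.
rewrite le_eqVlt; apply/orP; left; apply/eqP; apply: eq_integral => y _.
by rewrite -rmorphB /cabs /= normr0 addr0.
Qed.

Lemma fourier_C0 f : cintegrable mu f -> fourier f \in C0_pred R dual.
Proof.
move=> [rf jf]; have [_ fC] := fourier_C0_funZD 'i%C (fourier_C0_real jf) (fourier_C0_real rf).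
rewrite (_ : f = (fun y => 'i%C * ((complex.Im (f y))%:C)%C + ((complex.Re (f y))%:C)%C)).
  exact: fC.
by apply/funext => y; rewrite [LHS]complexE addrC.
Qed.

End FourierC0.

(** * The Fourier doublet *)

Section C0Algebra.
Context {R : realType} {G : topologicalZmodType}.
Local Notation dual := (dual R G).
Local Notation C0 := (C0 R dual).

Lemma C0_commutative_algebra : commutative_algebra (@C0_mul R dual).
Proof.
split.
- by move=> s t u; apply: C0_ext => x /=; rewrite mulrA.
- by move=> s t; apply: C0_ext => x /=; rewrite mulrC.
- by move=> s t u; apply: C0_ext => x /=; rewrite -mulrDl.
- by move=> a s t; apply: C0_ext => x /=; rewrite -scalerAl.
Qed.

Lemma C0_actE (s : C0) (c : circle R) (x : G) (xi eta : dual) :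
  C0_act s (c, x, xi) eta =
  val (duality (eta - xi) x) * (val c * s (eta - xi)).
Proof. by []. Qed.

Lemma C0_right_heisenberg :
  right_heisenberg_algebra (@C0_mul R dual) (@C0_act R G).
Proof.
split.
- exact: C0_commutative_algebra.
- move=> s; apply: C0_ext => eta; rewrite C0_actE subr0 bichar0r.
  by rewrite !mul1r.
- move=> g h s; case: g => -[c x] xi; case: h => -[c' x'] xi'; apply: C0_ext => eta.
  rewrite -[LHS]/(C0_act s ((c * c' * duality xi x')%g, x + x', xi + xi') eta) !C0_actE.
  have -> : eta - (xi + xi') = eta - xi' - xi by rewrite opprD addrA addrAC.
  (* In the iterated action x' is paired with a point not yet shifted by xi; the discrepancy is the
     twist of the Heisenberg product. *)
  have -> : duality (eta - xi') x' = (duality (eta - xi' - xi) x' * duality xi x')%g.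
    by rewrite -bicharDl subrK.
  by rewrite bicharDr !val_circleM; ring.
- move=> [[c x] xi] a s t; apply: C0_ext => eta.
  rewrite -[RHS]/(a * C0_act s (c, x, xi) eta + C0_act t (c, x, xi) eta) !C0_actE.
  rewrite -[(a *: s + t) _]/(a * s (eta - xi) + t (eta - xi)); ring.
- move=> c s; apply: C0_ext => eta; rewrite C0_actE subr0 bichar0r.
  by rewrite mul1r.
- move=> x s t; apply: C0_ext => eta.
  rewrite -[RHS]/(s eta * C0_act t (1%g, x, 0) eta) !C0_actE subr0.
  rewrite -[C0_mul s t _]/(s eta * t eta); ring.
- move=> xi s t; apply: C0_ext => eta.
  rewrite -[RHS]/(C0_act s (1%g, 0, xi) eta * C0_act t (1%g, 0, xi) eta) !C0_actE.
  by rewrite bichar0r !mul1r.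
Qed.

Lemma C0_right_reversal :
  right_reversal (@C0_mul R dual) (@C0_act R G) (@C0_reversal R G).
Proof.
split.
- by split=> [a s t|s t]; apply: C0_ext.
- by move=> s; apply: C0_ext => eta /=; rewrite opprK.
- move=> x s; apply: C0_ext => eta.
  rewrite -[LHS]/(C0_act s (1%g, x, 0) (- eta)) !C0_actE !subr0.
  by rewrite bicharNl bicharNr.
- move=> xi s; apply: C0_ext => eta.
  rewrite -[LHS]/(C0_act s (1%g, 0, xi) (- eta)) !C0_actE !bichar0r.
  by rewrite -[C0_reversal s _]/(s (- (eta - - xi))) opprB addrC.
Qed.

End C0Algebra.

(** * The Fourier operator and its compatibility with actions and reversals *)

Section FourierTransform.
Context {R : realType} {G : topologicalZmodType} (mu : haar_measure R G).
Hypothesis hausG : hausdorff_space G.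
Hypothesis lcG : locally_compact [set: G].
Local Notation dual := (dual R G).
Implicit Types (f g : L1_fun mu) (s t : L1 mu).

Definition fourier_transform s : C0 R dual :=
  MkC0 (fourier_C0 hausG (L1_integrable (L1_repr s))).

Lemma is_fourier_transform_fourier_transform : is_fourier_transform fourier_transform.
Proof.
move=> f xi; rewrite /= /fourier; apply: ae_eq_cintegral.
- exact: cintegrable_cmeasurable (cintegrable_char xi (L1_integrable _)).
- exact: cintegrable_cmeasurable (cintegrable_char xi (L1_integrable f)).
- apply: (@filterS (borel G) (almost_everywhere mu) _ _ _ _ (L1_class_repr f)) => y.
  by move=> ->.
Qed.

Lemma fourier_transform_class f (xi : dual) :
  fourier_transform (L1_class f) xi = fourier mu f xi.
Proof. exact: is_fourier_transform_fourier_transform. Qed.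

Lemma fourier_transform_operator : fourier_operator (L1_conv hausG lcG)
  (@L1_act R G mu) (@C0_mul R dual) (@C0_act R G) fourier_transform.
Proof.
split.
- split=> [a s t|s t]; rewrite -(L1_reprK s) -(L1_reprK t); apply: C0_ext => xi.
    rewrite L1_classZD /= !fctE.
    rewrite -[LHS]/(fourier_transform (L1_class (a *: L1_repr s + L1_repr t)) xi).
    rewrite -[RHS]/(a * fourier_transform (L1_class (L1_repr s)) xi +
      fourier_transform (L1_class (L1_repr t)) xi).
    rewrite !fourier_transform_class.
    exact: (fourierZD a xi (L1_integrable (L1_repr s)) (L1_integrable (L1_repr t))).
  rewrite L1_conv_class.
  rewrite -[RHS]/(fourier_transform (L1_class (L1_repr s)) xi *
      fourier_transform (L1_class (L1_repr t)) xi).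
  rewrite !fourier_transform_class /fourier.
  have is_ := L1_integrable (L1_repr s); have it := L1_integrable (L1_repr t).
  (* The product of the transforms at xi is the integral of the convolution of the two modulated
     functions, which is the modulated convolution almost everywhere. *)
  have [_ i e] := conv_integrable hausG lcG (cintegrable_char xi is_) (cintegrable_char xi it).
  rewrite -e; apply: ae_eq_cintegral.
  + have [_ ic _] := conv_integrable hausG lcG is_ it.
    exact: cintegrable_cmeasurable (cintegrable_char xi ic).
  + exact: cintegrable_cmeasurable i.
  + exact: conv_modulation.
- move=> x s; rewrite -(L1_reprK s) L1_act_class; apply: C0_ext => xi.
  rewrite -[RHS]/(val (duality (xi - 0) x) * (1 * fourier_transform (L1_class (L1_repr s)) (xi - 0))).
  rewrite mul1r subr0 !fourier_transform_class.
  have i := L1_integrable (L1_repr s).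
  rewrite /fourier -(cintegralZ _ (cintegrable_char xi i)).
  have ix : cintegrable mu (fun y : borel G => L1_repr s (y - x)).
    exact: (cintegrable_preserving (addr_borel (- x)) (haar_addr mu (- x)) i).
  have mx := cintegrable_cmeasurable (cintegrable_char xi ix).
  transitivity (cintegral mu (fun y => val (xi y) * L1_repr s (y - x))).
    by congr cintegral; apply/funext => y; rewrite /= !fctE /= scale1r mul1r.
  rewrite -(cintegral_preserving (addr_borel x) (haar_addr mu x) mx).
  congr cintegral; apply/funext => y.
  by rewrite addrK charD val_circleM -mulrA mulrCA.
- move=> xi s; rewrite -(L1_reprK s) L1_act_class; apply: C0_ext => eta.
  (* Acting by - xi evaluates the transform at eta + xi, and the pairing with eta + xi is the
     product of the pairings with eta and xi. *)
  rewrite -[RHS]/(val (duality (eta - - xi) 0) * (1 * fourier_transform (L1_class (L1_repr s)) (eta - - xi))).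
  rewrite mul1r bichar0r mul1r opprK !fourier_transform_class /fourier.
  congr cintegral; apply/funext => y; rewrite /= !fctE /= scale1r subr0.
  by rewrite mulrA.
Qed.

Lemma fourier_transform_reversal s :
  fourier_transform (L1_reversal hausG lcG s) = C0_reversal (fourier_transform s).
Proof.
rewrite -(L1_reprK s) L1_reversal_class; apply: C0_ext => xi.
rewrite -[RHS]/(fourier_transform (L1_class (L1_repr s)) (- xi)).
rewrite !fourier_transform_class /fourier.
have m := cintegrable_cmeasurable (cintegrable_char (- xi) (L1_integrable (L1_repr s))).
rewrite -(cintegral_preserving (@oppr_borel G) (haar_oppr mu hausG lcG) m).
congr cintegral; apply/funext => y; congr (_ * _).
by rewrite -[RHS]/(val (duality (- xi) (- y))) bicharNl bicharNr invgK.
Qed.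

End FourierTransform.

Theorem theorem36 (R : realType) (G : topologicalZmodType)
    (hausG : hausdorff_space G) (lcG : locally_compact [set: G])
    (mu : haar_measure R G) :
  exists (conv : L1 mu -> L1 mu -> L1 mu) (P : L1 mu -> L1 mu)
         (F : L1 mu -> C0 R (dual R G)),
    [/\ is_convolution conv, is_L1_reversal P, is_fourier_transform F &
        @fourier_doublet_with_reversals R G (dual R G) (@duality R G)
          (L1 mu) (C0 R (dual R G))
          conv (@L1_act R G mu) P
          (@C0_mul R (dual R G)) (@C0_act R G) (@C0_reversal R G)
          F].
Proof.
exists (L1_conv hausG lcG), (L1_reversal hausG lcG), (fourier_transform hausG); split.
- exact: is_convolution_L1_conv.
- exact: is_L1_reversal_L1_reversal.
- exact: is_fourier_transform_fourier_transform.
split.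
- split; [exact: L1_left_heisenberg|exact: C0_right_heisenberg|].
  exact: fourier_transform_operator.
- exact: L1_left_reversal.
- exact: C0_right_reversal.
- exact: fourier_transform_reversal.
Qed.
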